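(* Let $d\ge3$, let $H_0:\mathbb{Z}^d\to\mathbb{R}$ satisfy $0\le H_0\le\overline{H}_0$ in $\mathbb{Z}^d$ and, for some $\varepsilon_0\in(0,1)$, $\limsup_{|x|\to+\infty}\frac{(\overline{H}_0(x)-H_0(x))|x|^{\varepsilon_0}}{\overline{H}_0(x)}\in[0,+\infty)$, and let $g:\mathbb{Z}^d\to[0,+\infty)$. Consider the Poisson problem $$\mathcal{L}_\mu u=g\ \text{ in }\mathbb{Z}^d,\qquad u\ge0\ \text{ in }\mathbb{Z}^d.\qquad(P)$$ (a) If $\mu\ge-1$, with in addition $H_0<\overline{H}_0$ in $\mathbb{Z}^d$ if $\mu=-1$, and $$\sum_{x\in\mathbb{Z}^d}g(x)(1+|x|)^{\tau_-}<+\infty,$$ then (P) has a minimal nonnegative solution $v_g$. (b) If $\mu\ge-1$ and $$\sum_{x\in\mathbb{Z}^d}g(x)(1+|x|)^{\tau_-}=+\infty,$$ then (P) has no solutions. (c) If $\mu<-1$, then (P) has no solutions for any nonnegative $g$ that is not identically zero.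
   Context: $\mathbb{Z}^d$ is the integer lattice graph with $x\sim y$ iff $\sum_k|x_k-y_k|=1$; $|x|$ is the Euclidean norm; $\Delta u(x)=\sum_{y\sim x}(u(y)-u(x))$. $\Phi_d$ is the fundamental solution of $-\Delta$: $-\Delta\Phi_d=\delta_0$ in $\mathbb{Z}^d$ ($\delta_0$ equals $1$ at $0$ and $0$ elsewhere), $\lim_{|x|\to\infty}\Phi_d(x)=0$. The function $\overline{H}_0$ is defined by $\overline{H}_0(x)=-[\Delta\Phi_d^{1/2}(x)]\,\Phi_d^{-1/2}(x)$; it is known that $\overline{H}_0>0$ and $\overline{H}_0(x)=\frac{(d-2)^2}{4}|x|^{-2}+O(|x|^{-3})$ as $|x|\to\infty$. The Hardy operator is $\mathcal{L}_\mu u=-\Delta u+\mu H_0u$, $\mu\in\mathbb{R}$. For $\mu\ge-1$, $\tau_-=\tau_-(\mu)=\frac{2-d}{2}(1+\sqrt{1+\mu})$. A minimal solution is one which is pointwise not larger than any other solution of the problem. *)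

(* Defs.v *)
From HB Require Import structures.
From mathcomp Require Import all_boot all_order all_algebra.
From mathcomp Require Import all_classical all_reals all_analysis.

Set Implicit Arguments.
Unset Strict Implicit.
Unset Printing Implicit Defensive.

Import Order.TTheory GRing.Theory Num.Theory.
Import numFieldNormedType.Exports.

Local Open Scope classical_set_scope.
Local Open Scope ring_scope.

Definition lattice (d : nat) := 'rV[int]_d.

Definition adj (d : nat) (x y : lattice d) : bool :=
  \sum_(k < d) `|x 0 k - y 0 k| == 1.

(* \sum_(y \in A) is the finitely supported sum, which is 0 by convention on
   infinite supports; [finite_neighbors] shows that this never happens here. *)
Definition laplacian (R : realType) (d : nat) (u : lattice d -> R)
    (x : lattice d) : R :=
  \sum_(y \in [set y | adj x y]) (u y - u x).

Definition enorm (R : realType) (d : nat) (x : lattice d) : R :=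
  Num.sqrt (\sum_(k < d) ((x 0 k)%:~R : R) ^+ 2).

(* The filter of the sets containing {x | M < |x|} for some M, so that
   [f @ at_infinity R d --> l] is the limit of f as |x| -> oo. *)
Definition at_infinity (R : realType) (d : nat) : set_system (lattice d) :=
  [set A | exists M : R, forall x, M < enorm R x -> A x].
Arguments at_infinity : clear implicits.

(* This is limf_esup unfolded: limf_esup itself requires a filteredType, and
   'rV[int]_d has no such structure. *)
Definition limsup_at_infinity (R : realType) (d : nat)
    (f : lattice d -> \bar R) : \bar R :=
  ereal_inf [set ereal_sup (f @` V) | V in at_infinity R d].

Definition fundamental_solution (R : realType) (d : nat)
    (Phi : lattice d -> R) : Prop :=
  (forall x, - laplacian Phi x = (x == 0)%:R) /\
  (Phi @ at_infinity R d --> (0 : R)).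

(* Phi is positive when it is the fundamental solution, so Num.sqrt is the
   genuine square root. *)
Definition Hbar (R : realType) (d : nat) (Phi : lattice d -> R)
    (x : lattice d) : R :=
  - laplacian (fun y => Num.sqrt (Phi y)) x * (Num.sqrt (Phi x))^-1.

Definition hardy_op (R : realType) (d : nat) (H0 : lattice d -> R) (mu : R)
    (u : lattice d -> R) (x : lattice d) : R :=
  - laplacian u x + mu * H0 x * u x.

Definition tau_minus (R : realType) (d : nat) (mu : R) : R :=
  (2 - d%:R) / 2 * (1 + Num.sqrt (1 + mu)).

Definition poisson_solution (R : realType) (d : nat) (H0 : lattice d -> R)
    (mu : R) (g u : lattice d -> R) : Prop :=
  (forall x, hardy_op H0 mu u x = g x) /\ (forall x, 0 <= u x).

Definition minimal_poisson_solution (R : realType) (d : nat)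
    (H0 : lattice d -> R) (mu : R) (g v : lattice d -> R) : Prop :=
  poisson_solution H0 mu g v /\
  forall u, poisson_solution H0 mu g u -> forall x, v x <= u x.

Definition weighted_sum (R : realType) (d : nat) (mu : R)
    (g : lattice d -> R) : \bar R :=
  \esum_(x in [set: lattice d])
    (g x * (1 + enorm R x) `^ tau_minus d mu)%:E.

Lemma at_infinity_filter (R : realType) (d : nat) : Filter (at_infinity R d).
Proof.
split; first by exists 0.
  move=> A B [M HA] [N HB]; exists (Num.max M N) => x.
  by rewrite gt_max => /andP[/HA Ax /HB Bx].
by move=> A B AB [M HA]; exists M => x /HA /AB.
Qed.
#[export] Existing Instance at_infinity_filter.

Lemma finite_neighbors (d : nat) (x : lattice d) :
  finite_set [set y : lattice d | adj x y].
Proof.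
pose F (p : 'I_d * bool) : lattice d :=
  \row_k (x 0 k + (if k == p.1 then (if p.2 then 1 else -1) else 0)).
apply: (@sub_finite_set _ _ (F @` [set: 'I_d * bool])); last first.
  exact: finite_image.
move=> y /= /eqP xy.
have [i ni] : exists i, x 0 i != y 0 i.
  apply: contrapT => /forallNP h; move: xy; rewrite big1 // => k _.
  by have /negP := h k; rewrite negbK => /eqP ->; rewrite subrr normr0.
move: xy; rewrite (bigD1 i) //= => xy.
have n1 : 1 <= `|x 0 i - y 0 i|.
  by rewrite -gtz0_ge1 normr_gt0 subr_eq0.
have r0 : 0 <= \sum_(k < d | k != i) `|x 0 k - y 0 k|.
  by apply: sumr_ge0 => *; exact: normr_ge0.
have r1 : \sum_(k < d | k != i) `|x 0 k - y 0 k| = 0.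
  by apply/eqP; rewrite eq_le r0 andbT -(lerD2l `|x 0 i - y 0 i|) xy addr0.
have n2 : `|x 0 i - y 0 i| = 1 by rewrite -xy r1 addr0.
exists (i, y 0 i == x 0 i + 1) => //; apply/rowP => k; rewrite mxE /=.
case: (eqVneq k i) => [->|ki]; last first.
  move: r1 => /(psumr_eq0P (fun i _ => normr_ge0 _)) /(_ k ki) /eqP.
  by rewrite normr_eq0 subr_eq0 addr0 => /eqP.
case: eqP => [->//|ny].
move/eqP: n2; rewrite eqr_norml => /andP[/orP[]/eqP e _].
  by rewrite -e opprB addrC subrK.
by case: ny; rewrite -[1]opprK -e opprB addrC subrK.
Qed.

(* Main.v *)
(* Put alpha = (1 + sqrt (1 + mu)) / 2, so that 4 alpha (alpha - 1) = mu. A Taylor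
   expansion gives - Laplacian (Phi^b) = (4 b (1 - b) + small) Hbar Phi^b at infinity,
   where the error is governed by the relative increments of Phi. Comparison with
   explicit barriers (a perturbed |x|^(2-d), and a dipole in a half-space for the
   increments) shows that Phi is comparable to |x|^(2-d) and that its relative
   increments are bounded by a power of Phi. Hence Phi^alpha -+ Phi^(alpha + e) is a
   super/subsolution at infinity, and Phi^alpha is comparable to the weight
   (1 + |x|)^tau_-.

   (a) Gluing the supersolution with Phi^(1/2) gives a global positive supersolution;
   pairing it with truncated monotone iterates, which are finitely supported
   subsolutions, bounds these by the weighted sum of g, so they converge to the minimal
   solution.
   (b) The positive part of Phi^b + Phi^(b + e) - eps Phi^(1/2), with b > alpha, is a
   finitely supported test function; pairing it with a solution and letting b -> alpha
   and eps -> 0 bounds the weighted sum of g. Taking b > alpha avoids any logarithmic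
   correction at mu = -1.
   (c) For mu < -1 the equation oscillates: Phi^(1/2) times a suitable function of
   log Phi is a compactly supported nonnegative subsolution, which no positive
   supersolution allows. *)
Require Import Defs.
From mathcomp Require Import all_boot all_order all_algebra.
From mathcomp Require Import all_classical all_reals all_analysis.
From mathcomp Require Import ring lra zify.

Set Implicit Arguments.
Unset Strict Implicit.
Unset Printing Implicit Defensive.

Import Order.TTheory GRing.Theory Num.Theory.
Import numFieldNormedType.Exports.

Local Open Scope classical_set_scope.
Local Open Scope ring_scope.

(** * Neighbour sums, the discrete Laplacian and minimum principles on the lattice *)

Definition dirvec (d : nat) (k : 'I_d) : lattice d := \row_j (j == k)%:R.

(** An ordinary sum over the 2d unit steps, equal by [nsumE] to the finitely supported sum;
    linearity and monotonicity are direct for it. *)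
Definition nsum (R : realType) (d : nat) (F : lattice d -> R) (x : lattice d) : R :=
  \sum_(k < d) (F (x + dirvec k) + F (x - dirvec k)).

Lemma dist_eq1_split (a b S : int) :
  a != b -> `|a - b| + S = 1 -> 0 <= S -> S = 0 /\ (b = a + 1 \/ b = a - 1).
Proof. lia. Qed.

Section Lattice.
Variables (R : realType) (d : nat).
Implicit Types (x y : lattice d) (k j : 'I_d) (u v F : lattice d -> R).

Lemma adjP x y :
  reflect (exists k, y = x + dirvec k \/ y = x - dirvec k) (adj x y).
Proof.
apply: (iffP idP); last first.
  move=> [k [->|->]]; rewrite /adj (bigD1 k) //= big1 => [|j jk];
    by rewrite !mxE ?eqxx ?(negbTE jk) /= ?mulr1n ?mulr0n ?addr0 ?subr0 ?subrr //; lia.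
move=> /eqP xy.
have [i ni] : exists i, x 0 i != y 0 i.
  apply: contrapT => /forallNP h; move: xy; rewrite big1 // => k _.
  by have /negP := h k; rewrite negbK => /eqP ->; rewrite subrr normr0.
exists i; move: xy; rewrite (bigD1 i) //= => xy.
have r0 : 0 <= \sum_(k < d | k != i) `|x 0 k - y 0 k| by apply: sumr_ge0.
have [r1 yi] := dist_eq1_split ni xy r0.
have e j : j != i -> y 0 j = x 0 j.
  move=> ji; move: r1 => /(psumr_eq0P (fun i _ => normr_ge0 _)) /(_ j ji) /eqP.
  by rewrite normr_eq0 subr_eq0 => /eqP.
by case: yi => yi; [left|right]; apply/rowP => j; rewrite !mxE;
  case: (eqVneq j i) => [->|/e ->]; rewrite ?yi //= ?addr0 ?subr0.
Qed.

(** The signed unit steps reach each neighbour of [x] exactly once. *)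
Lemma nsumE F x : nsum F x = \sum_(y \in [set y | adj x y]) F y.
Proof.
pose f (p : 'I_d * bool) := if p.2 then x + dirvec p.1 else x - dirvec p.1.
have finj : injective f.
  move=> [k b] [j c] /rowP e.
  have := e k; have := e j; rewrite /f.
  by case: b c {e} => -[] /=; rewrite !mxE ?eqxx;
    (case: (eqVneq k j) => [->|kj]; rewrite ?eqxx /= ?(eq_sym j) ?(negbTE kj)); 
    rewrite ?eqxx /=; try lia.
have -> : [set y | adj x y] = f @` [set: 'I_d * bool].
  apply/seteqP; split => y /=.
    by move/adjP => [k [->|->]]; [exists (k, true)|exists (k, false)].
  by move=> [[k b] _ <-]; apply/adjP; exists k; case: b; [left|right].
rewrite fsbig_image; last by move=> a b _ _; exact: finj.
rewrite fsbig_finite //=.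
rewrite (_ : \sum_(i <- _) _ = \sum_(p : 'I_d * bool) F (f p)).
  rewrite -(pair_bigA _ (fun k b => F (f (k, b)))) /=; apply: eq_bigr => k _.
  by rewrite big_bool.
apply: perm_big; apply: uniq_perm; rewrite ?finmap.fset_uniq ?index_enum_uniq //.
move=> p; rewrite mem_index_enum in_fset_set; first exact/mem_set.
exact: finite_finset.
Qed.

Lemma nsumD u v x : nsum (fun y => u y + v y) x = nsum u x + nsum v x.
Proof. by rewrite /nsum -big_split /=; apply: eq_bigr => k _; ring. Qed.

Lemma nsumZ a u x : nsum (fun y => a * u y) x = a * nsum u x.
Proof. by rewrite /nsum mulr_sumr; apply: eq_bigr => k _; ring. Qed.

Lemma nsumN u x : nsum (fun y => - u y) x = - nsum u x.
Proof. by rewrite /nsum -sumrN; apply: eq_bigr => k _; ring. Qed.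

Lemma nsumB u v x : nsum (fun y => u y - v y) x = nsum u x - nsum v x.
Proof. by rewrite nsumD nsumN. Qed.

Lemma nsum_cst (a : R) x : nsum (fun=> a) x = 2 * d%:R * a.
Proof.
rewrite /nsum sumr_const card_ord -[_ *+ d]mulr_natl; ring.
Qed.

Lemma eq_nsum u v x : (forall y, adj x y -> u y = v y) -> nsum u x = nsum v x.
Proof.
move=> uv; apply: eq_bigr => k _.
by rewrite !uv //; apply/adjP; exists k; [right|left].
Qed.

Lemma ler_nsum u v x :
  (forall y, adj x y -> u y <= v y) -> nsum u x <= nsum v x.
Proof.
move=> uv; apply: ler_sum => k _.
by apply: lerD; apply: uv; apply/adjP; exists k; [left|right].
Qed.

Lemma nsum_ge0 u x : (forall y, adj x y -> 0 <= u y) -> 0 <= nsum u x.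
Proof.
move=> u0; apply: sumr_ge0 => k _.
by apply: addr_ge0; apply: u0; apply/adjP; exists k; [left|right].
Qed.

Lemma le_nsum u x y :
  (forall y, adj x y -> 0 <= u y) -> adj x y -> u y <= nsum u x.
Proof.
move=> u0 /adjP[k yE]; rewrite /nsum (bigD1 k) //=.
have p0 : 0 <= u (x + dirvec k) by apply: u0; apply/adjP; exists k; left.
have m0 : 0 <= u (x - dirvec k) by apply: u0; apply/adjP; exists k; right.
have r0 : 0 <= \sum_(j < d | j != k) (u (x + dirvec j) + u (x - dirvec j)).
  apply: sumr_ge0 => j _; apply: addr_ge0; apply: u0; apply/adjP; exists j.
    by left.
  by right.
by case: yE => ->; lra.
Qed.

Lemma ler_norm_nsum u x : `|nsum u x| <= nsum (fun y => `|u y|) x.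
Proof.
rewrite /nsum; apply: le_trans (ler_norm_sum _ _ _) _.
by apply: ler_sum => k _; exact: ler_normD.
Qed.

Lemma laplacian_nsum u x : laplacian u x = nsum (fun y => u y - u x) x.
Proof. by rewrite nsumE. Qed.

Lemma laplacianE u x : laplacian u x = nsum u x - 2 * d%:R * u x.
Proof. by rewrite laplacian_nsum nsumB nsum_cst. Qed.

Lemma laplacianD u v x :
  laplacian (fun y => u y + v y) x = laplacian u x + laplacian v x.
Proof. by rewrite !laplacianE nsumD; ring. Qed.

Lemma laplacianZ a u x : laplacian (fun y => a * u y) x = a * laplacian u x.
Proof. by rewrite !laplacianE nsumZ; ring. Qed.

Lemma laplacianB u v x :
  laplacian (fun y => u y - v y) x = laplacian u x - laplacian v x.
Proof. by rewrite !laplacianE nsumB; ring. Qed.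

Lemma laplacian_lt0 u x : laplacian u x < 0 -> exists2 y, adj x y & u y < u x.
Proof.
move=> u0; apply: contrapT => h.
move: u0; apply/negP; rewrite -leNgt laplacian_nsum.
apply: nsum_ge0 => y xy; rewrite subr_ge0 leNgt; apply/negP => yx.
by apply: h; exists y.
Qed.

(** Connectedness of the lattice: walk from [x0] to [x] along one coordinate axis after another. *)
Lemma adj_ind (P : lattice d -> Prop) x0 :
  P x0 -> (forall x y, adj x y -> P x -> P y) -> forall x, P x.
Proof.
move=> P0 PS.
have Pp x k (n : nat) : P x -> P (x + dirvec k *+ n) /\ P (x - dirvec k *+ n).
  move=> Px; elim: n => [|n [IHp IHm]]; first by rewrite mulr0n addr0 subr0.
  split; [apply: PS IHp|apply: PS IHm]; apply/adjP; exists k; [left|right].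
    by rewrite mulrSr addrA.
  by rewrite mulrSr opprD addrA.
have Pz x k (z : int) : P x -> P (x + dirvec k *~ z).
  move=> Px; case: (intP z) => [|n|n]; first by rewrite mulr0z addr0.
    by rewrite -pmulrn; case: (Pp x k n.+1 Px).
  by rewrite mulrNz -pmulrn; case: (Pp x k n.+1 Px).
move=> x.
have -> : x = x0 + \sum_(k < d) dirvec k *~ (x 0 k - x0 0 k).
  apply/rowP => j; rewrite !mxE summxE (bigD1 j) //= big1 => [|k kj].
    by rewrite addr0 -scaler_int !mxE eqxx mulr1 intz; lia.
  by rewrite -scaler_int !mxE eq_sym (negbTE kj) mulr0.
elim: (index_enum _) => [|k s IH]; first by rewrite big_nil addr0.
by rewrite big_cons addrCA addrC; exact: Pz.
Qed.

Lemma adj_sym x y : adj x y = adj y x.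
Proof. by rewrite /adj; under eq_bigr do rewrite distrC. Qed.

Lemma enorm_ge0 x : 0 <= enorm R x.
Proof. exact: sqrtr_ge0. Qed.

Lemma sqr_enorm x : enorm R x ^+ 2 = \sum_(k < d) ((x 0 k)%:~R : R) ^+ 2.
Proof. by rewrite sqr_sqrtr // sumr_ge0 // => k _; exact: sqr_ge0. Qed.

Lemma finite_ball (M : R) : finite_set [set x : lattice d | enorm R x <= M].
Proof.
pose N := (Num.truncn `|M|).+1.
pose f (A : 'rV['I_(N + N).+1]_d) : lattice d := \row_k ((A 0 k : nat)%:Z - N%:Z).
apply: (@sub_finite_set _ _ (f @` setT)); last exact: finite_image.
move=> x /= xM.
have b k : `|x 0 k| <= N%:Z.
  rewrite -(ler_int R) intr_norm.
  have : `|(x 0 k)%:~R| <= `|M|.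
    rewrite -ler_sqr ?nnegrE // real_normK ?num_real //.
    apply: (@le_trans _ _ (enorm R x ^+ 2)); last first.
      rewrite ler_sqr ?nnegrE ?enorm_ge0 //; apply: le_trans xM _.
      exact: ler_norm.
    rewrite sqr_enorm (bigD1 k) //= lerDl sumr_ge0 // => j _; exact: sqr_ge0.
  move=> h; apply: le_trans h _; apply: ltW; exact: truncnS_gt.
exists (\row_k inord (absz (x 0 k + N%:Z))) => //.
apply/rowP => k; rewrite !mxE inordK; first by have := b k; lia.
have := b k; lia.
Qed.

Lemma near_finite (P : lattice d -> Prop) :
  (\forall x \near at_infinity R d, P x) -> finite_set [set x | ~ P x].
Proof.
move=> [M HM]; apply: sub_finite_set (finite_ball M) => x /= nP.
by rewrite leNgt; apply/negP => /HM.
Qed.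

Lemma finite_near (A : set (lattice d)) :
  finite_set A -> \forall x \near at_infinity R d, ~ A x.
Proof.
move=> /finite_seqP[s ->].
exists (\sum_(y <- s) enorm R y) => x xs /= xins.
move: xs; apply/negP; rewrite -leNgt.
elim: s xins => // y s IH; rewrite in_cons big_cons => /orP[/eqP <-|/IH].
  by rewrite lerDl sumr_ge0 // => *; exact: enorm_ge0.
by move=> h; apply: le_trans h _; rewrite lerDr enorm_ge0.
Qed.

(** Only finitely many points violate [P], and each has finitely many neighbours. *)
Lemma finite_adj_near (P : lattice d -> Prop) :
  (\forall x \near at_infinity R d, P x) ->
  \forall x \near at_infinity R d, P x /\ forall y, adj x y -> P y.
Proof.
move=> nP; have fin := near_finite nP.
have fin2 : finite_set (\bigcup_(x in [set x | ~ P x]) [set y | adj x y]).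
  by apply: bigcup_finite => // x _; exact: finite_neighbors.
near=> x; split; first by near: x.
move=> y xy; apply: contrapT => nPy.
have : ~ (\bigcup_(x in [set x | ~ P x]) [set y | adj x y]) x.
  by near: x; exact: finite_near.
by apply; exists y => //=; rewrite adj_sym.
Unshelve. all: by end_near. Qed.

(** Properness of the filter at infinity: multiples of a unit vector leave every ball. *)
Lemma far_exists : (0 < d)%N -> forall P : lattice d -> Prop,
  (\forall x \near at_infinity R d, P x) -> exists x, P x.
Proof.
move=> d0 P [M HM].
pose k := Ordinal d0; pose n := (Num.truncn `|M|).+1.
exists (\row_j (if j == k then n%:Z else 0)); apply: HM.
rewrite /enorm (bigD1 k) //= big1 => [|j jk]; last first.
  by rewrite mxE (negbTE jk) expr0n.
rewrite mxE eqxx addr0 sqrtr_sqr; apply: le_lt_trans (ler_norm M) _.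
by rewrite -pmulrn [ltRHS]ger0_norm ?ler0n //; exact: truncnS_gt.
Qed.

Lemma finite_pos_min (A : set (lattice d)) (f : lattice d -> R) :
  finite_set A -> (forall x, A x -> 0 < f x) ->
  exists2 m : R, 0 < m & forall x, A x -> m <= f x.
Proof.
move=> /finite_seqP[s ->] /=; elim: s => [|y s IH] fpos; first by exists 1.
have [x xs|m m0 hm] := IH; first by apply: fpos; rewrite in_cons xs orbT.
exists (Num.min m (f y)) => [|x].
  by rewrite lt_min m0 /= fpos // mem_head.
by rewrite in_cons ge_min => /orP[/eqP ->|/hm ->//]; rewrite lexx orbT.
Qed.

Lemma finite_bounded (A : set (lattice d)) (f : lattice d -> R) :
  finite_set A -> exists2 K : R, 0 < K & forall x, A x -> f x <= K.
Proof.
move=> fA.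
have [m m0 hm] := @finite_pos_min A (fun x => (1 + `|f x|)^-1) fA
  (fun x _ => ltac:(rewrite invr_gt0 ltr_pwDl //)).
exists m^-1 => [|x /hm h]; first by rewrite invr_gt0.
apply: le_trans (ler_norm _) _; apply: (@le_trans _ _ (1 + `|f x|)).
  by rewrite lerDr.
by rewrite -[leLHS]invrK lef_pV2 // posrE invr_gt0 ltr_pwDl.
Qed.

(** If [v] were negative at [x0], the set where [v <= v x0] would be finite, and the second
    hypothesis would fail at a minimum over it. *)
Lemma min_principle v :
  (forall e : R, 0 < e -> \forall x \near at_infinity R d, - e < v x) ->
  (forall x, v x < 0 -> exists y, v y < v x) ->
  forall x, 0 <= v x.
Proof.
move=> v0 step x0; rewrite leNgt; apply/negP => neg.
have /near_finite fin : \forall x \near at_infinity R d, v x0 < v x.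
  by rewrite -[v x0]opprK; apply: v0; rewrite oppr_gt0.
move: fin => /finite_seqP[s hs].
have ex : exists x, v x <= v x0 /\ forall y, y \in s -> v x <= v y.
  elim: s {hs} => [|y s [x [xx0 hx]]]; first by exists x0.
  have [yx|xy] := leP (v y) (v x).
    exists y; split; first exact: le_trans yx xx0.
    by move=> z; rewrite in_cons => /orP[/eqP -> //|/hx]; exact: le_trans.
  exists x; split => // z; rewrite in_cons => /orP[/eqP ->|/hx //].
  exact: ltW.
have [x [xx0 hx]] := ex.
have [y yx] := step x (le_lt_trans xx0 neg).
have ys : y \in s.
  have : [set x | ~ v x0 < v x] y.
    by move=> /= h; move: (lt_le_trans h (le_trans (ltW yx) xx0)); rewrite ltxx.
  by rewrite hs.
by move: (hx y ys); rewrite leNgt yx.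
Qed.

(** At a negative global minimum all neighbours share the value; by connectedness [v] would be a
    negative constant, against its behaviour at infinity. *)
Lemma superharmonic_ge0 v : (0 < d)%N ->
  (forall e : R, 0 < e -> \forall x \near at_infinity R d, - e < v x) ->
  (forall x, laplacian v x <= 0) ->
  forall x, 0 <= v x.
Proof.
move=> d0 v0 sup; apply: min_principle => // x0 neg.
apply: contrapT => /forallNP h.
have vmin y : v x0 <= v y by rewrite leNgt; apply/negP; exact: h.
have allm : forall x, v x = v x0.
  apply: (@adj_ind _ x0) => // x y xy vx.
  apply/eqP; rewrite eq_le vmin andbT -subr_le0 -vx.
  apply: (@le_trans _ _ (nsum (fun y => v y - v x) x)).
    by apply: (@le_nsum (fun y => v y - v x)) => // z _; rewrite subr_ge0 vx.
  by rewrite -laplacian_nsum.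
have [x] := far_exists d0 (v0 (- v x0) ltac:(rewrite oppr_gt0 //)).
by rewrite opprK allm ltxx.
Qed.

(** Strong minimum principle: a zero of the nonnegative [v] spreads to the whole lattice. *)
Lemma superharmonic_gt0 v : (0 < d)%N ->
  (forall e : R, 0 < e -> \forall x \near at_infinity R d, - e < v x) ->
  (forall x, laplacian v x <= 0) -> (exists x, laplacian v x != 0) ->
  forall x, 0 < v x.
Proof.
move=> d0 v0 sup [x1 nz] x0; have vp := superharmonic_ge0 d0 v0 sup.
rewrite lt_neqAle vp andbT; apply/eqP => z0.
have all0 : forall x, v x = 0.
  apply: (@adj_ind _ x0) => // x y xy vx.
  apply/eqP; rewrite eq_le vp andbT; apply: le_trans (@le_nsum v x y _ xy) _ => //.
  by have := sup x; rewrite laplacianE vx mulr0 subr0.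
by move: nz; rewrite laplacianE /nsum big1 => [|k _]; rewrite !all0 ?mulr0 ?subr0 ?addr0 ?eqxx.
Qed.

End Lattice.

(** * Taylor estimates for real powers near 1, uniform in bounded exponents *)

Section PowerTaylor.
Variable R : realType.
Implicit Types (a b t B K : R).

Lemma ler_powRl r x y : 0 <= r -> 0 <= x -> x <= y -> x `^ r <= y `^ r :> R.
Proof.
by move=> r0 x0 xy; apply: ge0_ler_powR; rewrite ?nnegrE // (le_trans x0).
Qed.

Lemma powR_le2 a b B : 2^-1 <= a <= 3 / 2 -> `|b| <= B -> a `^ b <= 2 `^ B.
Proof.
move=> /andP[a1 a2] bB; have a0 : 0 < a by lra.
apply: (@le_trans _ _ (2 `^ `|b|)); last by apply: ler_powR => //; lra.
case: (ger0P b) => b0; first by apply: ler_powRl; lra.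
have -> : a `^ b = (a^-1) `^ (- b).
  by rewrite -powR_inv1 ?ltW // -powRrM mulN1r opprK.
apply: ler_powRl; rewrite ?invr_ge0; [lra|lra|].
by rewrite -[leRHS]invrK lef_pV2 ?posrE //; lra.
Qed.

(** One integration by the mean value theorem, which raises the order of vanishing at 1 by one. *)
Lemma mvt_pow_bound (f df : R -> R) K n : f 1 = 0 -> 0 <= K ->
  (forall a, 2^-1 <= a <= 3 / 2 -> is_derive a 1 f (df a)) ->
  (forall a, 2^-1 <= a <= 3 / 2 -> `|df a| <= K * `|a - 1| ^+ n) ->
  forall a, 2^-1 <= a <= 3 / 2 -> `|f a| <= K * `|a - 1| ^+ n.+1.
Proof.
move=> f1 K0 fd dfK a aI.
have cf x y : 2^-1 <= x -> y <= 3 / 2 -> {within `[x, y], continuous f}.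
  move=> x1 y1; apply: derivable_within_continuous => z.
  rewrite in_itv /= => /andP[xz zy].
  have zI : 2^-1 <= z <= 3 / 2 by lra.
  exact: (@ex_derive _ _ _ _ _ _ _ (fd z zI)).
have bnd c : 2^-1 <= c <= 3 / 2 -> `|c - 1| <= `|a - 1| ->
    f a - f 1 = df c * (a - 1) -> `|f a| <= K * `|a - 1| ^+ n.+1.
  move=> cI ca; rewrite f1 subr0 => ->.
  rewrite normrM exprSr mulrA ler_wpM2r //; apply: le_trans (dfK c cI) _.
  by rewrite ler_wpM2l // lerXn2r ?nnegrE.
have fd' (x y z : R) : 2^-1 <= x -> y <= 3 / 2 -> z \in `]x, y[%R -> is_derive z 1 f (df z).
  by rewrite in_itv /= => x1 y1 /andP[xz zy]; apply: fd; lra.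
case/andP: aI => aI1 aI2; have [a1|a1] := leP a 1.
- have [||c] := @MVT_segment _ f df a 1 a1; [|apply: cf; lra|].
    by move=> x; apply: fd'; lra.
  rewrite in_itv /= => /andP[c1 c2] e.
  apply: (bnd c); first by lra.
    by rewrite !ler0_norm; lra.
  by rewrite -opprB e -mulrN opprB.
- have [||c] := @MVT_segment _ f df 1 a (ltW a1); [|apply: cf; lra|].
    by move=> x; apply: fd'; lra.
  rewrite in_itv /= => /andP[c1 c2] e.
  apply: (bnd c) => //; first by lra.
  by rewrite !ger0_norm; lra.
Qed.

Lemma is_derive_affine b (x : R) : is_derive x 1 (fun y : R => b * (y - 1)) (b * (1 - 0)).
Proof. exact: (@is_deriveZ R R^o R^o (fun y => y - 1) b x 1 (1 - 0)). Qed.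

Lemma is_derive_powRB1 b (x : R) : 0 < x ->
  is_derive x 1 (fun y : R => y `^ b - 1) (b * x `^ (b - 1) - 0).
Proof.
move=> x0.
exact: (@is_deriveB R R^o R^o (fun y => y `^ b) (cst 1) x 1 _ _ (is_derive1_powR b x0)
  (is_derive_cst _ _ _)).
Qed.

Lemma is_derive_taylor1 b (x : R) : 0 < x ->
  is_derive x 1 (fun y : R => y `^ b - 1 - b * (y - 1))
    (b * x `^ (b - 1) - 0 - b * (1 - 0)).
Proof.
move=> x0.
exact: (@is_deriveB R R^o R^o (fun y => y `^ b - 1) (fun y => b * (y - 1)) x 1 _ _
  (is_derive_powRB1 b x0) (is_derive_affine b x)).
Qed.

Lemma is_derive_quad b (x : R) :
  is_derive x 1 (fun y : R => b * (y - 1) ^+ 2) (b * (2%:R * (x - 1) ^+ 1 * (1 - 0))).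
Proof.
apply: (@is_deriveZ R R^o R^o (fun y => (y - 1) ^+ 2) b x 1 (2%:R * (x - 1) ^+ 1 * (1 - 0))).
exact: (@is_deriveX R R^o (fun y => y - 1) 2 x 1 (1 - 0)).
Qed.

Lemma powR_taylor0 a b B : 2^-1 <= a <= 3 / 2 -> `|b| <= B ->
  `|a `^ b - 1| <= B * 2 `^ (B + 1) * `|a - 1|.
Proof.
move=> aI bB; have B0 : 0 <= B := le_trans (normr_ge0 _) bB.
rewrite -[X in _ * X]expr1.
apply: (@mvt_pow_bound (fun x => x `^ b - 1) (fun x => b * x `^ (b - 1) - 0)) => //.
- by rewrite powR1 subrr.
- by rewrite mulr_ge0 // powR_ge0.
- move=> x xI; have x0 : 0 < x by lra.
  exact: is_derive_powRB1.
- move=> x xI; rewrite subr0 expr0 mulr1 normrM.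
  apply: ler_pM => //; rewrite ger0_norm ?powR_ge0 //.
  apply: powR_le2 => //; apply: le_trans (ler_normB _ _) _.
  by rewrite normr1 lerD2r.
Qed.

(** The derivative of the remainder is [b] times the remainder of one order less for the exponent
    [b - 1]; [powR_taylor2] repeats this once more. *)
Lemma powR_taylor1 a b B : 2^-1 <= a <= 3 / 2 -> `|b| <= B ->
  `|a `^ b - 1 - b * (a - 1)| <= B * ((B + 1) * 2 `^ (B + 2)) * `|a - 1| ^+ 2.
Proof.
move=> aI bB; have B0 : 0 <= B := le_trans (normr_ge0 _) bB.
apply: (@mvt_pow_bound (fun x => x `^ b - 1 - b * (x - 1))
  (fun x => b * x `^ (b - 1) - 0 - b * (1 - 0))) => //.
- by rewrite powR1; ring.
- by rewrite !mulr_ge0 ?powR_ge0 //; lra.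
- move=> x xI; have x0 : 0 < x by lra.
  exact: is_derive_taylor1.
- move=> x xI; rewrite expr1 (_ : _ - _ = b * (x `^ (b - 1) - 1)); last by ring.
  rewrite normrM -!mulrA; apply: ler_pM => //.
  rewrite mulrA (_ : B + 2 = B + 1 + 1); last by ring.
  apply: powR_taylor0 => //; apply: le_trans (ler_normB _ _) _.
  by rewrite normr1 lerD2r.
Qed.

Lemma powR_taylor2 B : 0 <= B -> exists2 K : R, 0 < K & forall a b,
  2^-1 <= a <= 3 / 2 -> `|b| <= B ->
  `|a `^ b - 1 - b * (a - 1) - b * (b - 1) / 2 * (a - 1) ^+ 2|
     <= K * `|a - 1| ^+ 3.
Proof.
move=> B0; pose K := B * ((B + 1) * ((B + 2) * 2 `^ (B + 3))).
have K0 : 0 <= K by rewrite !mulr_ge0 ?powR_ge0 //; lra.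
exists (K + 1) => [|a b aI bB]; first lra.
apply: (@le_trans _ _ (K * `|a - 1| ^+ 3)); last first.
  by rewrite ler_wpM2r ?exprn_ge0 //; lra.
apply: (@mvt_pow_bound (fun x => x `^ b - 1 - b * (x - 1) - b * (b - 1) / 2 * (x - 1) ^+ 2)
  (fun x => b * x `^ (b - 1) - 0 - b * (1 - 0)
    - b * (b - 1) / 2 * (2%:R * (x - 1) ^+ 1 * (1 - 0)))) => //.
- by rewrite powR1; ring.
- move=> x xI; have x0 : 0 < x by lra.
  exact: (@is_deriveB R R^o R^o (fun y => y `^ b - 1 - b * (y - 1))
    (fun y => b * (b - 1) / 2 * (y - 1) ^+ 2) x 1 _ _ (is_derive_taylor1 b x0)
    (is_derive_quad _ _)).
- move=> x xI; rewrite (_ : _ - _ = b * (x `^ (b - 1) - 1 - (b - 1) * (x - 1))); last by field.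
  rewrite normrM -!mulrA; apply: ler_pM => //.
  rewrite [leRHS](_ : _ = (B + 1) * ((B + 1 + 1) * 2 `^ (B + 1 + 2)) * `|x - 1| ^+ 2); last first.
    rewrite (_ : B + 1 + 2 = B + 3); last by ring.
    by ring.
  apply: powR_taylor1 => //; apply: le_trans (ler_normB _ _) _.
  by rewrite normr1 lerD2r.
Qed.

End PowerTaylor.

(** * The Laplacian of a power of a positive function *)

Section PowerLaplacian.
Variable R : realType.

(** The second-order expansion at the ratios [h y / h x] is summed over the neighbours; the cubic
    remainder gives up one factor to [tau]. Since [K] depends on [B] alone, it serves both the
    barriers and [Phi]. *)
Lemma laplacian_powR (B : R) : 0 <= B -> exists2 K : R, 0 < K &
  forall (d : nat) (h : lattice d -> R) x tau b,
  0 < h x -> tau <= 2^-1 ->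
  (forall y, adj x y -> `|h y - h x| <= tau * h x) -> `|b| <= B ->
  `|laplacian (fun y => h y `^ b) x
     - h x `^ b * (b * (laplacian h x / h x)
        + b * (b - 1) / 2 * nsum (fun y => ((h y - h x) / h x) ^+ 2) x)|
  <= K * tau * nsum (fun y => ((h y - h x) / h x) ^+ 2) x * h x `^ b.
Proof.
move=> /(@powR_taylor2 R)[K K0 HK]; exists K => // d h x tau b hx tau2 hy bB.
set c := b * (b - 1) / 2.
pose D y := (h y - h x) / h x.
pose F y := h y `^ b - h x `^ b - h x `^ b * (b * D y + c * D y ^+ 2).
have -> : laplacian (fun y => h y `^ b) x
     - h x `^ b * (b * (laplacian h x / h x) + c * nsum (fun y => D y ^+ 2) x)
   = nsum F x.
  rewrite /F (nsumB (fun y => h y `^ b - h x `^ b)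
    (fun y => h x `^ b * (b * D y + c * D y ^+ 2))).
  rewrite (nsumZ _ (fun y => b * D y + c * D y ^+ 2)).
  rewrite (nsumD (fun y => b * D y) (fun y => c * D y ^+ 2)).
  rewrite (nsumZ b D) (nsumZ c (fun y => D y ^+ 2)) !laplacian_nsum.
  rewrite [nsum D x](_ : _ = nsum (fun y => h y - h x) x / h x) //.
  by rewrite mulrC -nsumZ; apply: eq_nsum => y _; rewrite /D mulrC.
rewrite mulrAC [_ * h x `^ b]mulrC.
rewrite -(nsumZ _ (fun y => ((h y - h x) / h x) ^+ 2)).
apply: le_trans (ler_norm_nsum _ _) _; apply: ler_nsum => y xy.
have hn0 : h x != 0 by rewrite gt_eqF.
have Dt : `|D y| <= tau.
  by rewrite /D normrM normfV (gtr0_norm hx) ler_pdivrMr // hy.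
have a1 : 2^-1 <= h y / h x <= 3 / 2.
  have -> : h y / h x = 1 + D y by rewrite /D; field.
  by move: Dt; rewrite ler_norml => /andP[]; lra.
have hy0 : 0 <= h y / h x by lra.
have := HK _ _ a1 bB; rewrite (_ : h y / h x - 1 = D y); last by rewrite /D; field.
move=> HE.
have -> : F y = h x `^ b * ((h y / h x) `^ b - 1 - b * D y - c * D y ^+ 2).
  rewrite !mulrBr -powRM ?(ltW hx) // mulrCA mulfV // mulr1 /F; ring.
rewrite normrM (ger0_norm (powR_ge0 _ _)) -[leRHS]mulrA ler_wpM2l ?powR_ge0 //.
apply: le_trans HE _; rewrite -[leRHS]mulrA ler_pM2l // exprS real_normK ?num_real //.
by rewrite ler_wpM2r // sqr_ge0.
Qed.

Lemma powRN_small (a e : R) : 0 < a -> 0 < e ->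
  exists M, forall h, M < h -> h `^ (- a) < e.
Proof.
move=> a0 e0; exists (e^-1 `^ a^-1) => h eh.
have h0 : 0 < h := le_lt_trans (powR_ge0 _ _) eh.
rewrite powRN -[e]invrK ltf_pV2 ?posrE ?invr_gt0 ?powR_gt0 //.
rewrite -[ltLHS]powRr1 ?invr_ge0 ?ltW // -(mulVf (lt0r_neq0 a0)) powRrM.
by apply: gt0_ltr_powR => //; rewrite nnegrE ?powR_ge0 // ltW.
Qed.

End PowerLaplacian.

(** * Powers of a shifted quadratic *)

Section Barriers.
Variables (R : realType) (d : nat).
Implicit Types (x y : lattice d) (c : 'I_d -> R).

Definition coord c x k : R := (x 0 k)%:~R + c k.
(** The polynomial 1 + |x + c|^2 is positive everywhere, so all its real powers are usable; the
    shift allows centres off the lattice. *)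
Definition hsq c x : R := \sum_(k < d) coord c x k ^+ 2 + 1.

Lemma coordD c x k j : coord c (x + dirvec k) j = coord c x j + (j == k)%:R.
Proof. by rewrite /coord !mxE intrD; case: (j == k); ring. Qed.

Lemma coordB c x k j : coord c (x - dirvec k) j = coord c x j - (j == k)%:R.
Proof. by rewrite /coord !mxE intrB; case: (j == k); ring. Qed.

Lemma hsqD c x k : hsq c (x + dirvec k) = hsq c x + 2 * coord c x k + 1.
Proof.
rewrite /hsq (bigD1 k) //= [in RHS](bigD1 k) //= coordD eqxx.
rewrite (eq_bigr (fun j => coord c x j ^+ 2)) => [|j jk]; last first.
  by rewrite coordD (negbTE jk) addr0.
by rewrite /=; ring.
Qed.

Lemma hsqB c x k : hsq c (x - dirvec k) = hsq c x - 2 * coord c x k + 1.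
Proof.
rewrite /hsq (bigD1 k) //= [in RHS](bigD1 k) //= coordB eqxx.
rewrite (eq_bigr (fun j => coord c x j ^+ 2)) => [|j jk]; last first.
  by rewrite coordB (negbTE jk) subr0.
by rewrite /=; ring.
Qed.

Lemma hsq_ge1 c x : 1 <= hsq c x.
Proof. by rewrite lerDr sumr_ge0 // => k _; exact: sqr_ge0. Qed.

Lemma hsq_gt0 c x : 0 < hsq c x.
Proof. exact: lt_le_trans ltr01 (hsq_ge1 c x). Qed.

Lemma coord_sqr_le c x k : coord c x k ^+ 2 <= hsq c x - 1.
Proof.
by rewrite /hsq addrK (bigD1 k) //= lerDl sumr_ge0 // => j _; exact: sqr_ge0.
Qed.

Lemma laplacian_hsq c x : laplacian (hsq c) x = 2 * d%:R.
Proof.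
rewrite laplacian_nsum /nsum.
rewrite (eq_bigr (fun=> 2)) => [|k _]; last by rewrite hsqD hsqB; ring.
by rewrite sumr_const card_ord -mulr_natl; ring.
Qed.

Lemma nsum_sqr_hsq c x :
  nsum (fun y => ((hsq c y - hsq c x) / hsq c x) ^+ 2) x =
  (8 * (hsq c x - 1) + 2 * d%:R) / hsq c x ^+ 2.
Proof.
rewrite /nsum.
rewrite (eq_bigr (fun k => (8 * coord c x k ^+ 2 + 2) / hsq c x ^+ 2)); last first.
  by move=> k _; rewrite hsqD hsqB; field; rewrite gt_eqF ?hsq_gt0.
rewrite -mulr_suml big_split /= -mulr_sumr sumr_const card_ord.
by rewrite [in RHS]/hsq addrK -[2 *+ d]mulr_natr.
Qed.

Lemma hsq_step c x y : adj x y ->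
  `|hsq c y - hsq c x| <= 3 * (Num.sqrt (hsq c x))^-1 * hsq c x.
Proof.
move=> xy; pose s : R := Num.sqrt (hsq c x).
have s2 : s ^+ 2 = hsq c x by rewrite sqr_sqrtr // ltW ?hsq_gt0.
have s1 : 1 <= s by rewrite -sqrtr1 ler_wsqrtr ?hsq_ge1.
have s0 : 0 < s by lra.
rewrite -/s -s2 (_ : 3 * s^-1 * s ^+ 2 = 3 * s); last by field; rewrite gt_eqF.
have cs k : `|coord c x k| <= s.
  by rewrite -ler_sqr ?nnegrE ?(ltW s0) // real_normK ?num_real // s2;
    have := coord_sqr_le c x k; lra.
case/adjP: xy => k [->|->]; rewrite ?hsqD ?hsqB s2.
  by have := cs k; rewrite !ler_norml => /andP[]; lra.
by have := cs k; rewrite !ler_norml => /andP[]; lra.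
Qed.

(** The leading coefficient is that of the continuous Laplacian of |x|^(2b), zero at b = 1 - d/2.
    From 36 on, the relative steps of [hsq_step] are at most 1/2, as [laplacian_powR] requires. *)
Lemma laplacian_hsq_powR (B : R) : 0 <= B -> exists2 K : R, 0 < K &
  forall c x b, `|b| <= B -> 36 <= hsq c x ->
  `|laplacian (fun y => hsq c y `^ b) x
     - hsq c x `^ b / hsq c x * (4 * b * (b - 1 + d%:R / 2))|
  <= K * (Num.sqrt (hsq c x))^-1 * (hsq c x `^ b / hsq c x).
Proof.
move=> B0; have [K K0 HK] := laplacian_powR B0.
(* The first summand pays for the Taylor remainder, the second for the lower-order part isolated in
   [E1]. *)
pose K' : R := K * 3 * (8 + 2 * d%:R) + B * (B + 1) * (d%:R + 4).
have K'0 : 0 < K'.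
  have d0 : 0 <= d%:R :> R by [].
  apply: ltr_wpDr; first by rewrite !mulr_ge0 //; lra.
  by rewrite !mulr_gt0 //; lra.
exists K' => // c x b bB h36.
set h := hsq c x; pose s : R := Num.sqrt h; have h0 : 0 < h := hsq_gt0 c x.
have s2 : s ^+ 2 = h by rewrite sqr_sqrtr // ltW.
have s6 : 6 <= s.
  rewrite -ler_sqr ?nnegrE ?sqrtr_ge0 // s2; apply: le_trans h36; lra.
have s0 : 0 < s by lra.
have := HK _ (hsq c) x (3 * s^-1) b h0 _ _ bB.
rewrite nsum_sqr_hsq laplacian_hsq -/h => /(_ _ (@hsq_step c x)) H.
have {}H : `|laplacian (fun y => hsq c y `^ b) x -
    h `^ b * (b * (2 * d%:R / h) + b * (b - 1) / 2 * ((8 * (h - 1) + 2 * d%:R) / h ^+ 2))| <=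
    K * (3 / s) * ((8 * (h - 1) + 2 * d%:R) / h ^+ 2) * h `^ b.
  by apply: H; rewrite ler_pdivrMr //; lra.
set P := h `^ b in H *; have P0 : 0 <= P := powR_ge0 _ _.
rewrite -(subrKA (P * (b * (2 * d%:R / h)
  + b * (b - 1) / 2 * ((8 * (h - 1) + 2 * d%:R) / h ^+ 2)))).
apply: le_trans (ler_normD _ _) _.
have hn : h != 0 by rewrite gt_eqF.
have sn : s != 0 by rewrite gt_eqF.
have E1 : P * (b * (2 * d%:R / h) + b * (b - 1) / 2 * ((8 * (h - 1) + 2 * d%:R) / h ^+ 2))
   - P / h * (4 * b * (b - 1 + d%:R / 2)) = P / h * (b * (b - 1) * (d%:R - 4) / h) by field.
rewrite E1.
have E2 : `|P / h * (b * (b - 1) * (d%:R - 4) / h)| <=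
    P / h * (B * (B + 1) * (d%:R + 4) / s).
  rewrite normrM ger0_norm ?divr_ge0 ?(ltW h0) // ler_wpM2l ?divr_ge0 ?(ltW h0) //.
  rewrite normrM normfV [`|h|]gtr0_norm //; apply: ler_pM; rewrite ?invr_ge0 ?(ltW h0) //.
    rewrite !normrM !ler_pM ?mulr_ge0 //.
      by apply: le_trans (ler_normB _ _) _; rewrite normr1 lerD2r.
    by apply: le_trans (ler_normB _ _) _; rewrite !ger0_norm.
  rewrite lef_pV2 ?posrE // -s2; nra.
have E3 : K * (3 / s) * ((8 * (h - 1) + 2 * d%:R) / h ^+ 2) * P <=
   P / h * (K * 3 * (8 + 2 * d%:R) / s).
  have -> : K * (3 / s) * ((8 * (h - 1) + 2 * d%:R) / h ^+ 2) * P =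
    P / h * (K * (3 / s) * ((8 * (h - 1) + 2 * d%:R) / h)) by field; rewrite hn.
  rewrite ler_wpM2l ?divr_ge0 ?(ltW h0) //.
  rewrite (_ : K * 3 * _ / s = K * (3 / s) * (8 + 2 * d%:R)); last by ring.
  rewrite ler_wpM2l ?mulr_ge0 ?invr_ge0 ?(ltW K0) ?(ltW s0) // ler_pdivrMr //.
  have d0 : 0 <= d%:R :> R by [].
  have h1 : 36 <= h := h36.
  have : 0 <= d%:R * (h - 1) by rewrite mulr_ge0 //; lra.
  by lra.
apply: le_trans (lerD (le_trans H E3) E2) _.
by rewrite -mulrDr [leRHS]mulrC ler_wpM2l ?divr_ge0 ?(ltW h0) // -mulrDl.
Qed.

End Barriers.

(** * A comparison principle and barriers at infinity *)

Section Comparison.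
Variables (R : realType) (d : nat).
Implicit Types (x y : lattice d) (c : 'I_d -> R) (u w : lattice d -> R).

(* With [D] a half-space, the third hypothesis is odd reflection across its boundary. *)
Lemma comparison (D : lattice d -> Prop) u w :
  (forall x, D x -> 0 < u x) ->
  (forall e : R, 0 < e -> \forall x \near at_infinity R d, D x -> w x < e) ->
  (forall x y, D x -> adj x y -> ~ D y -> u y = - u x /\ w y = - w x) ->
  (\forall x \near at_infinity R d, D x ->
    [/\ laplacian u x <= 0, 0 <= laplacian w x & laplacian u x < laplacian w x]) ->
  exists2 C : R, 0 < C & forall x, D x -> w x <= C * u x.
Proof.
move=> u0 w0 bd /near_finite fin.
have [C C0 HC] := finite_bounded (fun x => w x / u x) fin.
exists C => // z Dz.
pose v x := if `[< D x >] then C * u x - w x else 0.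
suff : 0 <= v z by rewrite /v asboolT // subr_ge0.
apply: min_principle => [e e0|x].
  near=> x; have wx : D x -> w x < e by near: x; exact: w0.
  rewrite /v; case: asboolP => [Dx|_]; last by rewrite oppr_lt0.
  by have := mulr_gt0 C0 (u0 x Dx); have := wx Dx; lra.
rewrite {1}/v; case: asboolP => [Dx|_]; last by rewrite ltxx.
move=> vx; have : laplacian (fun y => C * u y - w y) x < 0.
  rewrite laplacianB laplacianZ.
  have [[H1 H2 H3]|nA] := pselect ([/\ laplacian u x <= 0, 0 <= laplacian w x
      & laplacian u x < laplacian w x]).
    have [ux|ux] := ltP (laplacian u x) 0.
      by have : C * laplacian u x < 0; [rewrite nmulr_llt0|lra].
    have -> : laplacian u x = 0 by lra.
    lra.
  have : w x / u x <= C by apply: HC => /= h; apply: nA; exact: h.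
  rewrite ler_pdivrMr ?u0 // => h; lra.
move=> /laplacian_lt0[y xy yx]; exists y.
(* Outside [D], reflection would give the neighbour the positive value [- v x], so it could not lie
   below [v x]. *)
rewrite /v (asboolT Dx); case: asboolP => // nDy.
have [uy wy] := bd x y Dx xy nDy; move: yx; rewrite uy wy; lra.
Unshelve. all: by end_near. Qed.

Lemma hsq_lower c x : \sum_(k < d) c k ^+ 2 <= 4^-1 ->
  (1 + enorm R x) ^+ 2 <= 6 * hsq c x.
Proof.
move=> cs; have e : enorm R x ^+ 2 <= 2 * (hsq c x - 1) + 2 * 4^-1.
  apply: (@le_trans _ _ (2 * (hsq c x - 1) + 2 * \sum_(k < d) c k ^+ 2)).
    rewrite /hsq addrK sqr_enorm !mulr_sumr -big_split /=; apply: ler_sum => k _.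
    rewrite /coord; have := sqr_ge0 ((x 0 k)%:~R + 2 * c k); nra.
  by lra.
have := hsq_ge1 c x; have := sqr_ge0 (1 - enorm R x); nra.
Qed.

Lemma hsq_upper c x : \sum_(k < d) c k ^+ 2 <= 4^-1 ->
  hsq c x <= 2 * (1 + enorm R x) ^+ 2.
Proof.
move=> cs; have : hsq c x - 1 <= 2 * enorm R x ^+ 2 + 2 * 4^-1.
  apply: (@le_trans _ _ (2 * enorm R x ^+ 2 + 2 * \sum_(k < d) c k ^+ 2)).
    rewrite /hsq addrK sqr_enorm !mulr_sumr -big_split /=; apply: ler_sum => k _.
    rewrite /coord; have := sqr_ge0 ((x 0 k)%:~R - c k); nra.
  by lra.
have := enorm_ge0 R x; nra.
Qed.

Lemma near_enorm (M : R) : \forall x \near at_infinity R d, M < enorm R x.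
Proof. by exists M. Qed.

Lemma near_hsq c M : \sum_(k < d) c k ^+ 2 <= 4^-1 ->
  \forall x \near at_infinity R d, M < hsq c x.
Proof.
move=> cs; near=> x.
have : 3 * `|M| < enorm R x by near: x; exact: near_enorm.
have := hsq_lower x cs; have := ler_norm M; have := sqr_ge0 (enorm R x); nra.
Unshelve. all: by end_near. Qed.

Lemma near_hsq_powR c (a e : R) : \sum_(k < d) c k ^+ 2 <= 4^-1 ->
  0 < a -> 0 < e -> \forall x \near at_infinity R d, hsq c x `^ (- a) < e.
Proof.
move=> cs a0 e0; have [M HM] := powRN_small a0 e0.
by near=> x; apply: HM; near: x; exact: near_hsq.
Unshelve. all: by end_near. Qed.

Lemma hsq_powR_step c x b : hsq c x `^ (b - 4^-1) = hsq c x `^ b * hsq c x `^ (- 4^-1).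
Proof. by rewrite powRD //; apply/implyP => _; rewrite gt_eqF ?hsq_gt0. Qed.

Lemma hsq_powR_sqrt c x :
  (Num.sqrt (hsq c x))^-1 = (hsq c x `^ (- 4^-1)) ^+ 2.
Proof.
rewrite -powR12_sqrt ?(ltW (hsq_gt0 _ _)) // -powRN -powR_mulrn ?powR_ge0 //.
by rewrite -powRrM; congr (_ `^ _); field.
Qed.

Definition zero_shift : 'I_d -> R := fun=> 0.
(** The difference of [Phi] along an edge belongs to the midpoint of the edge, so its odd reflection
    is about the hyperplane with k-th coordinate -1/2, where [coord] with this shift vanishes. *)
Definition half_shift k : 'I_d -> R := fun j => (j == k)%:R / 2.

Lemma sum_sqr0 : \sum_(k < d) zero_shift k ^+ 2 <= 4^-1.
Proof. by rewrite big1 // => k _; rewrite expr0n. Qed.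

Lemma sum_sqr_half k : \sum_(j < d) half_shift k j ^+ 2 <= 4^-1.
Proof.
rewrite (bigD1 k) //= big1 => [|j jk]; rewrite /half_shift ?(negbTE jk).
  by rewrite eqxx mul1r; lra.
by rewrite mul0r expr0n.
Qed.

(** The exponent 1 - d/2 has leading coefficient 0, so the perturbation decides the sign: lowering
    the exponent by 1/4 gives the coefficient d/2 - 3/4 > 0. It is of relative order [r], the
    discretization error only of order [r ^+ 2]. *)
Lemma radial_barriers : (3 <= d)%N ->
  \forall x \near at_infinity R d,
    laplacian (fun y => hsq zero_shift y `^ (1 - d%:R / 2)
      - 2^-1 * hsq zero_shift y `^ (1 - d%:R / 2 - 4^-1)) x < 0 <
    laplacian (fun y => hsq zero_shift y `^ (1 - d%:R / 2)
      + 2^-1 * hsq zero_shift y `^ (1 - d%:R / 2 - 4^-1)) x.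
Proof.
move=> d3; have d3R : 3 <= d%:R :> R by rewrite ler_nat.
have [K K0 HK] := @laplacian_hsq_powR R d d%:R (ler0n _ _).
near=> x.
have h36 : 36 <= hsq zero_shift x by apply: ltW; near: x; exact: near_hsq sum_sqr0.
rewrite laplacianB laplacianD laplacianZ.
have b1 : `|1 - d%:R / 2| <= d%:R :> R by rewrite ler_norml; lra.
have b2 : `|1 - d%:R / 2 - 4^-1| <= d%:R :> R by rewrite ler_norml; lra.
have := HK zero_shift x _ b2 h36; have := HK zero_shift x _ b1 h36.
rewrite !hsq_powR_sqrt hsq_powR_step.
set L1 := laplacian _ x; set L2 := laplacian _ x.
set r := hsq zero_shift x `^ (- 4^-1).
pose A := hsq zero_shift x `^ (1 - d%:R / 2) / hsq zero_shift x.
have A0 : 0 < A by rewrite divr_gt0 ?powR_gt0 ?hsq_gt0.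
have r0 : 0 < r by rewrite powR_gt0 ?hsq_gt0.
have rK : r < (8 * (K + 1))^-1.
  rewrite /r; near: x; apply: near_hsq_powR => //; first exact: sum_sqr0.
  by rewrite invr_gt0; lra.
have r1 : r < 1.
  by apply: lt_trans rK _; rewrite invf_lt1; lra.
have Kr : K * r < 8^-1.
  move: rK; rewrite -ltf_pV2 ?posrE ?invr_gt0; [|lra|lra]; rewrite invrK => rK.
  rewrite -ltr_pdivlMr //; apply: lt_trans (_ : K < K + 1) _; first lra.
  by rewrite ltr_pdivlMl //; lra.
rewrite -[_ `^ _ / hsq zero_shift x]/A.
rewrite (_ : _ * r / hsq zero_shift x = A * r); last by rewrite /A mulrAC.
rewrite (_ : 1 - d%:R / 2 - 1 + d%:R / 2 = 0); last by ring.
rewrite mulr0 mulr0 subr0 => H1 H2.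
have {}H2 : `|L2 - A * r * (d%:R / 2 - 3 / 4)| <= K * r ^+ 2 * (A * r).
  by rewrite (_ : d%:R / 2 - 3 / 4 = 4 * (1 - d%:R / 2 - 4^-1) *
    (1 - d%:R / 2 - 4^-1 - 1 + d%:R / 2)) //; field.
pose q := A * r; have q0 : 0 < q by rewrite mulr_gt0.
have E1 : `|L1| <= q * 8^-1.
  apply: le_trans H1 _; rewrite (_ : K * r ^+ 2 * A = q * (K * r)); last by rewrite /q; ring.
  by rewrite ler_wpM2l ?(ltW q0) // ltW.
have E2 : K * r ^+ 2 * (A * r) <= q * 8^-1.
  rewrite (_ : _ * (A * r) = q * (K * r * r)); last by rewrite /q; ring.
  rewrite ler_wpM2l ?(ltW q0) //; apply: le_trans (_ : K * r <= _); last exact: ltW.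
  by rewrite ler_piMr ?mulr_ge0 ?(ltW K0) ?(ltW r0) // ltW.
have E3 : `|L2 - q * (d%:R / 2 - 3 / 4)| <= q * 8^-1 by apply: le_trans H2 E2.
have E4 : q * (3 / 4) <= q * (d%:R / 2 - 3 / 4) by rewrite ler_wpM2l ?(ltW q0) //; lra.
move: E1 E3; rewrite !ler_norml => /andP[E1 E1'] /andP[E3 E3'].
by apply/andP; split; lra.
Unshelve. all: by end_near. Qed.

(** Discrete product rule with an affine factor; only direction [k] yields a cross term. *)
Lemma laplacian_coordM c k (P : lattice d -> R) x :
  laplacian (fun y => coord c y k * P y) x =
  coord c x k * laplacian P x + (P (x + dirvec k) - P (x - dirvec k)).
Proof.
rewrite !laplacianE /nsum mulrBr (mulrCA _ (2 * d%:R)) -addrA [_ + (P _ - _)]addrC addrA.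
congr (_ - _); rewrite (bigD1 k) //= [in RHS](bigD1 k) //= !coordD !coordB eqxx.
rewrite (eq_bigr (fun j => coord c x k * (P (x + dirvec j) + P (x - dirvec j)))).
  by rewrite -mulr_sumr mulr1n; ring.
by move=> j jk; rewrite coordD coordB [k == j]eq_sym (negbTE jk) mulr0n; ring.
Qed.

(* The exact dipole [coord * hsq `^ (- d / 2)] is harmonic to leading order; the larger
   exponent leaves a negative margin that absorbs the discretization error. *)
Lemma dipole_barrier k : (3 <= d)%N ->
  \forall x \near at_infinity R d, 0 <= (x : lattice d) 0 k ->
    laplacian (fun y => coord (half_shift k) y k *
      hsq (half_shift k) y `^ (4^-1 - d%:R / 2)) x < 0.
Proof.
move=> d3; have d3R : 3 <= d%:R :> R by rewrite ler_nat.
pose g : R := d%:R / 2 - 4^-1; rewrite -[4^-1 - _]opprB -/g; set c := half_shift k.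
have [K1 K10 HK1] := @laplacian_hsq_powR R d d%:R (ler0n _ _).
have [K2 K20 HK2] := @powR_taylor2 R d%:R (ler0n _ _).
have gB : `|- g| <= d%:R by rewrite normrN ger0_norm /g; lra.
pose K := K1 + 4 * g * (g + 1) + 128 * K2.
have K0 : 0 < K.
  have : 0 <= g * (g + 1) by rewrite mulr_ge0 // /g; lra.
  by rewrite /K; lra.
near=> x => xk.
have h36 : 36 <= hsq c x by apply: ltW; near: x; exact: near_hsq (sum_sqr_half k).
have h64 : 64 <= hsq c x by apply: ltW; near: x; exact: near_hsq (sum_sqr_half k).
have hK : (8 * K) ^+ 2 < hsq c x by near: x; exact: near_hsq (sum_sqr_half k).
rewrite laplacian_coordM hsqD hsqB.
have := coord_sqr_le c x k; have := HK1 c x _ gB h36.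
have X2 : 2^-1 <= coord c x k.
  rewrite /coord /c /half_shift eqxx mul1r.
  have : 0 <= (x 0 k)%:~R :> R by rewrite ler0z.
  by lra.
set X := coord c x k in X2 *; set L := laplacian _ x.
set h := hsq c x in h36 h64 hK *; have h0 : 0 < h := hsq_gt0 c x.
have hn : h != 0 by rewrite gt_eqF.
set s := (Num.sqrt h)^-1.
have s0 : 0 < s by rewrite invr_gt0 sqrtr_gt0.
have s2 : s ^+ 2 = h^-1 by rewrite exprVn sqr_sqrtr // ltW.
move=> HL Xh.
have Xh2 : X ^+ 2 * s ^+ 2 <= 1 by rewrite s2 ler_pdivrMr //; lra.
have s6 : s <= 8^-1.
  rewrite -ler_sqr ?nnegrE ?(ltW s0) ?invr_ge0 // s2 -lef_pV2 ?posrE ?invr_gt0 ?exprn_gt0 //.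
  by rewrite invrK exprVn invrK; lra.
have sK : K * s < 8^-1.
  have : (8 * K) * s < 1; last by lra.
  rewrite -ltr_sqr ?nnegrE ?mulr_ge0 ?(ltW s0) ?(ltW K0) // expr1n exprMn s2.
  by rewrite ltr_pdivrMr // mul1r.
set P := h `^ (- g) in HL *; have P0 : 0 < P by rewrite powR_gt0.
(* Both increments [2 * X + 1] and [1 - 2 * X] of [hsq] in direction [k] qualify, because
   [X >= 1/2]. *)
have step (t : R) : `|t| <= 4 * X -> `|(h + t) `^ (- g)
    - P * (1 + - g * (t / h) + - g * (- g - 1) / 2 * (t / h) ^+ 2)| <=
    P * (K2 * (64 * X / h ^+ 2)).
  move=> tX; have t1 : `|t / h| <= 4 * X * s ^+ 2.
    by rewrite normrM normfV (gtr0_norm h0) s2 ler_wpM2r ?invr_ge0 ?(ltW h0).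
  have X0 : 0 <= X by lra.
  have Xs : X * s <= 1.
    by rewrite -(@expr_le1 _ 2) ?mulr_ge0 ?(ltW s0) // exprMn.
  have t2 : `|t / h| <= 2^-1.
    apply: le_trans t1 _; have := ler_pM (mulr_ge0 X0 (ltW s0)) (ltW s0) Xs s6; lra.
  rewrite (_ : h + t = h * ((h + t) / h)); last by field.
  have a1 : 2^-1 <= (h + t) / h <= 3 / 2.
    have -> : (h + t) / h = 1 + t / h by field.
    by move: t2; rewrite ler_norml => /andP[]; lra.
  rewrite powRM ?(ltW h0) //; last by lra.
  rewrite -mulrBr normrM (gtr0_norm P0) ler_wpM2l ?(ltW P0) //.
  have := HK2 _ _ a1 gB; rewrite (_ : (h + t) / h - 1 = t / h); last by field.
  rewrite !opprD !addrA => H; apply: le_trans H _.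
  rewrite ler_wpM2l ?(ltW K20) // exprS.
  apply: (@le_trans _ _ (4 * X * s ^+ 2 * (4 * X * s ^+ 2) ^+ 2)).
    by apply: ler_pM => //; rewrite ?sqr_ge0 // lerXn2r ?nnegrE //; apply: le_trans t1.
  rewrite (_ : 64 * X / h ^+ 2 = 64 * X * s ^+ 2 * s ^+ 2 * 1); last first.
    by rewrite mulr1 s2; field.
  rewrite (_ : _ * _ = 64 * X * s ^+ 2 * s ^+ 2 * (X ^+ 2 * s ^+ 2)); last by ring.
  by apply: ler_wpM2l => //; rewrite !mulr_ge0 ?exprn_ge0 ?(ltW s0) //.
have := step (2 * X + 1) ltac:(rewrite ler_norml; lra).
have := step (1 - 2 * X) ltac:(rewrite ler_norml; lra).
rewrite (_ : h + (1 - 2 * X) = h - 2 * X + 1); last by ring.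
rewrite (_ : h + (2 * X + 1) = h + 2 * X + 1); last by ring.
set Pm := (h - 2 * X + 1) `^ _; set Pp := (h + 2 * X + 1) `^ _.
rewrite !ler_norml => /andP[Sm _] /andP[_ Sp].
have {}HL : L <= P / h * (3 * g) + K1 * s * (P / h).
  move: HL; rewrite (_ : 4 * - g * (- g - 1 + d%:R / 2) = 3 * g); last by rewrite /g; field.
  by rewrite ler_norml => /andP[_]; lra.
have {}HL : X * L <= X * (P / h * (3 * g) + K1 * s * (P / h)) by rewrite ler_wpM2l //; lra.
have HD : Pp - Pm <= X * (P / h) * (- 4 * g + (4 * g * (g + 1) + 128 * K2) / h).
  pose T (t : R) := P * (1 + - g * (t / h) + - g * (- g - 1) / 2 * (t / h) ^+ 2).
  pose E := P * (K2 * (64 * X / h ^+ 2)).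
  apply: (@le_trans _ _ ((T (2 * X + 1) + E) - (T (1 - 2 * X) - E))).
    by move: Sm Sp; rewrite -/(T _) -/(T _) -/E; lra.
  rewrite /T /E.
  by rewrite le_eqVlt; apply/orP; left; apply/eqP; field.
have g1 : 5 / 4 <= g by rewrite /g; lra.
have gK : 0 <= 4 * g * (g + 1) + 128 * K2.
  by rewrite addr_ge0 ?mulr_ge0 //; lra.
have E : (4 * g * (g + 1) + 128 * K2) / h <= (4 * g * (g + 1) + 128 * K2) * s.
  by rewrite ler_wpM2l // -s2 expr2 ler_piMr ?(ltW s0) //; lra.
have Q0 : 0 < X * (P / h) by rewrite mulr_gt0 ?divr_gt0 //; lra.
have HD2 : X * (P / h) * (- 4 * g + (4 * g * (g + 1) + 128 * K2) / h) <=
   X * (P / h) * (- 4 * g + (4 * g * (g + 1) + 128 * K2) * s).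
  by rewrite ler_wpM2l ?(ltW Q0) // lerD2l.
(* The Laplacian of the power contributes [3 * g] and the centred difference [- 4 * g]; the
   remaining [- g] outweighs the error [K * s]. *)
have F : X * (P / h) * (- g + K * s) < 0.
  by rewrite pmulr_rlt0 //; lra.
apply: le_lt_trans F; apply: le_trans (lerD HL (le_trans HD HD2)) _.
by rewrite le_eqVlt; apply/orP; left; apply/eqP; rewrite /K; ring.
Unshelve. all: by end_near. Qed.

End Comparison.

(** * Two-sided bounds and increments of the fundamental solution *)

Section Fundamental.
Variables (R : realType) (d : nat) (Phi : lattice d -> R).
Hypothesis hd : (3 <= d)%N.
Hypothesis hPhi : fundamental_solution Phi.
Implicit Types (x y : lattice d) (k j : 'I_d).

Let d_gt0 : (0 < d)%N := leq_trans (isT : (0 < 3)%N) hd.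
Let d3 : 3 <= d%:R :> R. Proof. by rewrite ler_nat. Qed.

Lemma laplacian_Phi x : laplacian Phi x = - (x == 0)%:R.
Proof. by rewrite -(proj1 hPhi) opprK. Qed.

Lemma near_Phi e : 0 < e -> \forall x \near at_infinity R d, `|Phi x| < e.
Proof. exact/cvgr0_norm_lt/(proj2 hPhi). Qed.

Lemma Phi_gt0 x : 0 < Phi x.
Proof.
apply: superharmonic_gt0 => // [e e0|y|].
- by near=> y; have : `|Phi y| < e by [near: y; exact: near_Phi]; rewrite ltr_norml => /andP[].
- by rewrite laplacian_Phi oppr_le0.
- by exists 0; rewrite laplacian_Phi eqxx oppr_eq0 oner_eq0.
Unshelve. all: by end_near. Qed.

Lemma near_neq0 : \forall x \near at_infinity R d, x != 0.
Proof.
have := finite_near R (finite_set1 (0 : lattice d)).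
by apply: filterS => x /= /eqP.
Qed.

Definition weight x : R := 1 + enorm R x.

Lemma weight_ge1 x : 1 <= weight x.
Proof. by rewrite lerDl enorm_ge0. Qed.

Lemma weight_gt0 x : 0 < weight x.
Proof. exact: lt_le_trans ltr01 (weight_ge1 x). Qed.

Lemma sqr_powR_half (a b : R) : 0 <= a -> (a ^+ 2) `^ b = a `^ (2 * b).
Proof. by move=> a0; rewrite -powR_mulrn // -powRrM. Qed.

Lemma hsq_powR_le c x (b : R) : \sum_(k < d) c k ^+ 2 <= 4^-1 -> 0 <= b ->
  hsq c x `^ (- b) <= 6 `^ b * weight x `^ (- (2 * b)).
Proof.
move=> cs b0; rewrite !powRN -[6 `^ b]invrK -invfM -sqr_powR_half ?(ltW (weight_gt0 _)) //.
have w0 := weight_gt0 x.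
rewrite lef_pV2 ?posrE ?mulr_gt0 ?invr_gt0 ?powR_gt0 ?hsq_gt0 ?exprn_gt0 //.
rewrite ler_pdivrMl ?powR_gt0 // -powRM ?(ltW (hsq_gt0 _ _)) //.
by apply: ler_powRl => //; rewrite ?sqr_ge0 //; exact: hsq_lower.
Qed.

Lemma hsq_powR_ge c x (b : R) : \sum_(k < d) c k ^+ 2 <= 4^-1 -> 0 <= b ->
  2 `^ (- b) * weight x `^ (- (2 * b)) <= hsq c x `^ (- b).
Proof.
move=> cs b0; rewrite !powRN -invfM -sqr_powR_half ?(ltW (weight_gt0 _)) //.
have w0 := weight_gt0 x.
rewrite lef_pV2 ?posrE ?mulr_gt0 ?powR_gt0 ?hsq_gt0 ?exprn_gt0 //.
rewrite -powRM ?sqr_ge0 //.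
by apply: ler_powRl; rewrite ?(ltW (hsq_gt0 _ _)) //; exact: hsq_upper.
Qed.

Let z := @zero_shift R d.
Let p : R := d%:R / 2 - 1.
Let p_ge0 : 0 <= p. Proof. by move: d3; rewrite /p; lra. Qed.

Lemma hsq_small (a e : R) : 0 < a -> 0 < e ->
  \forall x \near at_infinity R d, hsq z x `^ (- a) < e.
Proof. by move=> a0 e0; apply: near_hsq_powR => //; exact: sum_sqr0. Qed.

(** Comparison on the whole lattice with the superharmonic barrier of [radial_barriers], which the
    factor 1/2 keeps positive. *)
Lemma Phi_le_weight : exists2 C : R, 0 < C &
  forall x, Phi x <= C * weight x `^ (2 - d%:R).
Proof.
have [||//||C C0 HC] := @comparison R d (fun=> True) (fun y => hsq z y `^ (1 - d%:R / 2)
      - 2^-1 * hsq z y `^ (1 - d%:R / 2 - 4^-1)) Phi.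
- move=> x _; rewrite hsq_powR_step; set r := hsq z x `^ (- 4^-1).
  have r1 : r <= 1.
    by rewrite -(powRr0 (hsq z x)); apply: ler_powR; [exact: hsq_ge1|lra].
  have := powR_gt0 (1 - d%:R / 2) (hsq_gt0 z x); nra.
- move=> e e0; near=> x => _; apply: le_lt_trans (ler_norm _) _.
  by near: x; exact: near_Phi.
- apply: filterS2 (radial_barriers R hd) near_neq0 => x /andP[h _] xn0 _.
  by rewrite laplacian_Phi (negbTE xn0) oppr0 lexx ltW.
exists (C * 6 `^ p) => [|x]; first by rewrite mulr_gt0 ?powR_gt0.
apply: le_trans (HC x I) _; rewrite -mulrA ler_pM2l //.
have -> : 2 - d%:R = - (2 * p) by rewrite /p; field.
apply: le_trans (hsq_powR_le x (sum_sqr0 R d) p_ge0).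
rewrite (_ : - p = 1 - d%:R / 2); last by rewrite /p; ring.
by rewrite gerBl mulr_ge0 ?powR_ge0.
Unshelve. all: by end_near. Qed.

(** The same comparison with [Phi] as the upper function and the subharmonic barrier below it. *)
Lemma Phi_ge_weight : exists2 c : R, 0 < c &
  forall x, c * weight x `^ (2 - d%:R) <= Phi x.
Proof.
have [x _|e e0|//||C C0 HC] := @comparison R d (fun=> True) Phi
   (fun y => hsq z y `^ (1 - d%:R / 2) + 2^-1 * hsq z y `^ (1 - d%:R / 2 - 4^-1)).
- exact: Phi_gt0.
- near=> x => _.
  have : hsq z x `^ (- p) < e / 2 by near: x; apply: hsq_small; move: d3; rewrite /p; lra.
  rewrite hsq_powR_step (_ : - p = 1 - d%:R / 2); last by rewrite /p; ring.
  set r := hsq z x `^ (- 4^-1) => h.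
  have r1 : r <= 1.
    by rewrite -(powRr0 (hsq z x)); apply: ler_powR; [exact: hsq_ge1|lra].
  have := powR_gt0 (1 - d%:R / 2) (hsq_gt0 z x); nra.
- apply: filterS2 (radial_barriers R hd) near_neq0 => x /andP[_ h] xn0 _.
  by rewrite laplacian_Phi (negbTE xn0) oppr0 lexx ltW.
exists (C^-1 * 2 `^ (- p)) => [|x]; first by rewrite mulr_gt0 ?invr_gt0 ?powR_gt0.
rewrite -mulrA ler_pdivrMl //; apply: le_trans (HC x I).
have -> : 2 - d%:R = - (2 * p) by rewrite /p; field.
apply: le_trans (hsq_powR_ge x (sum_sqr0 R d) p_ge0) _.
rewrite (_ : - p = 1 - d%:R / 2); last by rewrite /p; ring.
by rewrite lerDl mulr_ge0 ?powR_ge0.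
Unshelve. all: by end_near. Qed.

Definition refl k x : lattice d := \row_j (if j == k then - x 0 j else x 0 j).

Lemma refl_nsum k (u : lattice d -> R) x : nsum (fun y => u (refl k y)) x = nsum u (refl k x).
Proof.
apply: eq_bigr => j _; have [->|jk] := eqVneq j k.
  rewrite addrC; congr (u _ + u _); apply/rowP => i; rewrite !mxE;
    by case: (eqVneq i k) => //= _; rewrite ?mulr1n ?mulr0n; ring.
congr (u _ + u _); apply/rowP => i; rewrite !mxE;
  by case: (eqVneq i k) => // ->; rewrite [k == j]eq_sym (negbTE jk) mulr0n; ring.
Qed.

Lemma refl0 k x : (refl k x == 0) = (x == 0).
Proof.
apply/eqP/eqP => /rowP h; apply/rowP => i; have := h i; rewrite !mxE; case: eqP => // _ e.
  by apply: oppr_inj; rewrite e oppr0.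
by rewrite e oppr0.
Qed.

Lemma enorm_refl k x : enorm R (refl k x) = enorm R x.
Proof.
congr Num.sqrt; apply: eq_bigr => i _; rewrite mxE; case: eqP => // _.
by rewrite mulrNz sqrrN.
Qed.

(** Uniqueness of the decaying solution: both differences of [Phi] and its reflection are harmonic
    and tend to 0. *)
Lemma Phi_refl k x : Phi (refl k x) = Phi x.
Proof.
have nr (e : R) : 0 < e -> \forall x \near at_infinity R d, `|Phi (refl k x) - Phi x| < e.
  move=> e0; have e2 : 0 < e / 2 by rewrite divr_gt0.
  have [M HM] := near_Phi e2; exists M => y My.
  by apply: le_lt_trans (ler_normB _ _) _; rewrite [ltRHS]splitr ltrD // HM // enorm_refl.
have lap y : laplacian (fun y => Phi (refl k y)) y = laplacian Phi y.
  by rewrite laplacianE refl_nsum -laplacianE !laplacian_Phi refl0.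
apply/le_anti/andP; split; rewrite -subr_ge0.
- apply: (superharmonic_ge0 (v := fun y => Phi y - Phi (refl k y))) => // [e e0|y].
    by near=> y; have : `|Phi (refl k y) - Phi y| < e;
      [near: y; exact: nr | rewrite ltr_norml => /andP[]; lra].
  by rewrite laplacianB lap subrr.
- apply: (superharmonic_ge0 (v := fun y => Phi (refl k y) - Phi y)) => // [e e0|y].
    by near=> y; have : `|Phi (refl k y) - Phi y| < e;
      [near: y; exact: nr | rewrite ltr_norml => /andP[]; lra].
  by rewrite laplacianB lap subrr.
Unshelve. all: by end_near. Qed.

Lemma laplacian_shift a x : laplacian (fun y => Phi (y + a)) x = laplacian Phi (x + a).
Proof.
rewrite !laplacianE; congr (_ - _); apply: eq_bigr => j _.
by rewrite addrAC [x - _ + a]addrAC.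
Qed.

(* By [Phi_refl] this difference is odd under reflection across the boundary of the
   half-space, so it decays like a dipole, one order faster than [Phi]. *)
Lemma Phi_diff_half k (s : R) : `|s| = 1 -> exists2 C : R, 0 < C & forall x, 0 <= x 0 k ->
  s * (Phi x - Phi (x + dirvec k)) <=
  C * (coord (half_shift R k) x k * hsq (half_shift R k) x `^ (4^-1 - d%:R / 2)).
Proof.
move=> s1.
have [x xk|e e0|x y xk xy nyk||C C0 HC] := @comparison R d (fun x => 0 <= x 0 k)
  (fun x => coord (half_shift R k) x k * hsq (half_shift R k) x `^ (4^-1 - d%:R / 2))
  (fun x => s * (Phi x - Phi (x + dirvec k))).
- rewrite mulr_gt0 ?powR_gt0 ?hsq_gt0 // /coord /half_shift eqxx mul1r.
  by rewrite ltr_wpDl // ler0z.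
- have e2 : 0 < e / 2 by rewrite divr_gt0.
  have := finite_adj_near (near_Phi e2); apply: filterS => x [H1 H2] _.
  apply: le_lt_trans (ler_norm _) _; rewrite normrM s1 mul1r.
  apply: le_lt_trans (ler_normB _ _) _; rewrite [ltRHS]splitr ltrD //.
  by apply: H2; apply/adjP; exists k; left.
- have [yE xk0] : y = x - dirvec k /\ x 0 k = 0.
    case/adjP: xy nyk => j [->|->]; rewrite !mxE; case: (eqVneq k j) => [<-|kj].
    + by case; apply: addr_ge0.
    + by case; apply: addr_ge0.
    + move=> h; split => //; apply/eqP; rewrite eq_le xk andbT leNgt.
      by apply/negP => h2; apply: h; rewrite subr_ge0.
    + by case; rewrite subr0.
  have -> : x + dirvec k = refl k y.
    apply/rowP => i; rewrite yE !mxE; case: eqP => [->|_]; last by rewrite mulr0n; ring.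
    by rewrite xk0 /=; ring.
  rewrite Phi_refl yE subrK hsqB coordB.
  have -> : coord (half_shift R k) x k = 2^-1.
    by rewrite /coord /half_shift xk0 eqxx mul1r add0r.
  rewrite eqxx mulfV ?pnatr_eq0 // subrK; split; last by ring.
  by rewrite mulr1n -[RHS]mulNr; congr (_ * _); field.
- apply: filterS2 (dipole_barrier R k hd) near_neq0 => x H xn0 xk.
  have xe : x + dirvec k != 0.
    by apply/eqP => /rowP /(_ k); rewrite !mxE eqxx /= => e; move: xk; lia.
  rewrite laplacianZ laplacianB laplacian_shift !laplacian_Phi (negbTE xn0) (negbTE xe).
  by rewrite oppr0 subr0 mulr0 lexx H // ltW // H.
by exists C.
Qed.

(** The signs 1 and -1 in [Phi_diff_half] give the absolute value, and reflection gives the other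
    half-space. Bounding the coordinate by the square root of [hsq] adds 1/2 to the exponent. *)
Lemma Phi_diff k : exists2 C : R, 0 < C & forall x,
  `|Phi x - Phi (x + dirvec k)| <= C * hsq (half_shift R k) x `^ (- (d%:R / 2 - 3 / 4)).
Proof.
have [C1 C10 H1] := @Phi_diff_half k 1 (normr1 _).
have [|C2 C20 H2] := @Phi_diff_half k (-1); first by rewrite normrN1.
exists (C1 + C2) => [|x]; first by rewrite addr_gt0.
have half x' : 0 <= x' 0 k -> `|Phi x' - Phi (x' + dirvec k)| <=
    (C1 + C2) * hsq (half_shift R k) x' `^ (- (d%:R / 2 - 3 / 4)).
  move=> xk; have := H1 x' xk; have := H2 x' xk.
  set X := coord _ _ _; set h := hsq _ _.
  have h0 : 0 < h := hsq_gt0 _ _.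
  have X0 : 0 <= X.
    by rewrite /X /coord /half_shift eqxx mul1r addr_ge0 ?invr_ge0 // ler0z.
  have Xh : X * h `^ (4^-1 - d%:R / 2) <= h `^ (- (d%:R / 2 - 3 / 4)).
    have -> : - (d%:R / 2 - 3 / 4) = 2^-1 + (4^-1 - d%:R / 2) :> R by field.
    rewrite [leRHS]powRD; last by apply/implyP => _; rewrite gt_eqF.
    rewrite ler_wpM2r ?powR_ge0 // powR12_sqrt ?(ltW h0) //.
    rewrite -ler_sqr ?nnegrE ?sqrtr_ge0 // sqr_sqrtr ?(ltW h0) //.
    by have := coord_sqr_le (half_shift R k) x' k; rewrite -/X -/h; lra.
  have := ler_wpM2l (ltW C10) Xh; have := ler_wpM2l (ltW C20) Xh.
  have := mulr_ge0 (ltW C10) (powR_ge0 h (- (d%:R / 2 - 3 / 4))).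
  have := mulr_ge0 (ltW C20) (powR_ge0 h (- (d%:R / 2 - 3 / 4))).
  move=> P1 P2 P3 P4 P5 P6; rewrite ler_norml; apply/andP; split; lra.
have [xk|xk] := leP 0 (x 0 k); first exact: half.
(* The edge from [w] to [w + dirvec k] is the mirror image of the edge between [x + dirvec k] and
   [x]; the half shift makes [hsq] agree at [w] and [x]. *)
pose w := refl k (x + dirvec k).
have wk : 0 <= w 0 k by rewrite !mxE !eqxx /=; lia.
have wE : w + dirvec k = refl k x.
  by apply/rowP => i; rewrite !mxE; case: eqP => _; rewrite ?mulr1n ?mulr0n; ring.
have := half w wk; rewrite wE !Phi_refl distrC.
rewrite (_ : hsq (half_shift R k) w = hsq (half_shift R k) x) //.
congr (_ + 1); apply: eq_bigr => j _.
rewrite /coord /half_shift !mxE; case: eqP => _; last by rewrite mulr0n addr0.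
by rewrite mulr1n mulrNz intrD /=; field.
Qed.

(** A backward step is a forward step from [x - dirvec k], which flips the sign of the half shift.
    The exponent is half an order worse than that of a dipole, yet half an order better than that of
    [Phi]. *)
Lemma Phi_grad : exists2 C : R, 0 < C & forall x y, adj x y ->
  `|Phi y - Phi x| <= C * weight x `^ (3 / 2 - d%:R).
Proof.
have /choice[C HC] : forall k, exists C : R, 0 < C /\ forall x,
    `|Phi x - Phi (x + dirvec k)| <= C * hsq (half_shift R k) x `^ (- (d%:R / 2 - 3 / 4)).
  by move=> k; have [C C0 H] := Phi_diff k; exists C.
pose b : R := d%:R / 2 - 3 / 4; have b0 : 0 <= b by move: d3; rewrite /b; lra.
have S0 : 0 <= \sum_k C k by apply: sumr_ge0 => k _; exact: ltW (proj1 (HC k)).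
exists ((\sum_k C k + 1) * 6 `^ b) => [|x y xy].
  by rewrite mulr_gt0 ?powR_gt0 //; lra.
have -> : 3 / 2 - d%:R = - (2 * b) :> R by rewrite /b; field.
have main k (c : 'I_d -> R) (t : R) : \sum_(j < d) c j ^+ 2 <= 4^-1 ->
    t <= C k * hsq c x `^ (- b) ->
    t <= (\sum_k C k + 1) * 6 `^ b * weight x `^ (- (2 * b)).
  move=> cs tC; apply: le_trans tC _; rewrite -mulrA.
  apply: ler_pM; rewrite ?powR_ge0 //; first exact: ltW (proj1 (HC k)).
    rewrite (bigD1 k) //= -addrA lerDl addr_ge0 //.
    by apply: sumr_ge0 => j _; exact: ltW (proj1 (HC j)).
  exact: hsq_powR_le.
case/adjP: xy => k [->|->].
  rewrite distrC; apply: (main k (half_shift R k)); first exact: sum_sqr_half.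
  exact: (proj2 (HC k)).
apply: (main k (fun j => - half_shift R k j)).
  by under eq_bigr do rewrite sqrrN; exact: sum_sqr_half.
have := proj2 (HC k) (x - dirvec k); rewrite subrK.
rewrite (_ : hsq (half_shift R k) (x - dirvec k) = hsq (fun j => - half_shift R k j) x) //.
congr (_ + 1); apply: eq_bigr => j _.
by rewrite coordB /coord /half_shift; congr (_ ^+ 2); field.
Qed.

Lemma Phi_rel_grad : exists2 C : R, 0 < C & forall x y, adj x y ->
  `|Phi y - Phi x| <= C * weight x `^ (- 2^-1) * Phi x.
Proof.
have [C C0 HC] := Phi_grad; have [c c0 Hc] := Phi_ge_weight.
exists (C / c) => [|x y xy]; first by rewrite divr_gt0.
apply: le_trans (HC x y xy) _.
have -> : 3 / 2 - d%:R = - 2^-1 + (2 - d%:R) :> R by field.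
rewrite powRD; last by apply/implyP => _; rewrite gt_eqF // weight_gt0.
rewrite -!mulrA ler_pM2l // mulrCA ler_wpM2l ?powR_ge0 // ler_pdivlMl //.
Qed.

(** By the lower bound on [Phi], decay in |x| becomes a positive power of [Phi], the form in which
    errors combine with the barriers. *)
Lemma weight_powR_le_Phi (r : R) : 0 < r -> exists2 C : R, 0 < C &
  forall x, weight x `^ (- r) <= C * Phi x `^ (r / (d%:R - 2)).
Proof.
move=> r0; have [c c0 Hc] := Phi_ge_weight.
have d2 : 0 < d%:R - 2 :> R by move: d3; lra.
have rE : - r = (2 - d%:R) * (r / (d%:R - 2)) by field; rewrite gt_eqF.
have e0 : 0 <= r / (d%:R - 2) by rewrite divr_ge0 ?ltW.
move: (r / _) e0 rE => e e0 ->; exists (c^-1 `^ e) => [|x]; first by rewrite powR_gt0 ?invr_gt0.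
rewrite -powRM ?invr_ge0 ?(ltW c0) ?(ltW (Phi_gt0 x)) //.
rewrite powRrM; apply: ler_powRl => //; first exact: powR_ge0.
by rewrite ler_pdivlMl.
Qed.

Lemma Phi_bounded : exists2 M : R, 0 < M & forall x, Phi x <= M.
Proof.
have [C C0 HC] := Phi_le_weight; exists C => // x; apply: le_trans (HC x) _.
rewrite ler_piMr ?(ltW C0) // -[leRHS](powRr0 (weight x)); apply: ler_powR; first exact: weight_ge1.
by move: d3; lra.
Qed.

End Fundamental.

(** * The Hardy operator on powers of the fundamental solution *)

Section Hardy.
Variables (R : realType) (d : nat) (Phi H0 : lattice d -> R).
Hypothesis hd : (3 <= d)%N.
Hypothesis hPhi : fundamental_solution Phi.
Hypothesis hH0 : forall x, 0 <= H0 x <= Hbar Phi x.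
Implicit Types (x y : lattice d) (mu b : R).

Let d_gt0 : (0 < d)%N := leq_trans (isT : (0 < 3)%N) hd.
Let P_gt0 x : 0 < Phi x := Phi_gt0 hd hPhi x.
Let P_ge0 x : 0 <= Phi x := ltW (P_gt0 x).
Let Pb_gt0 x b : 0 < Phi x `^ b. Proof. exact: powR_gt0. Qed.

Lemma PhiD x (a b : R) : Phi x `^ (a + b) = Phi x `^ a * Phi x `^ b.
Proof. by rewrite powRD //; apply/implyP => _; rewrite gt_eqF. Qed.

Lemma HbarE x :
  Hbar Phi x * Phi x `^ 2^-1 = - laplacian (fun y => Phi y `^ 2^-1) x.
Proof.
rewrite /Hbar -powR12_sqrt // divfK ?gt_eqF //.
by congr (- laplacian _ x); apply/funext => y; rewrite powR12_sqrt.
Qed.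

Lemma Hbar_ge0 x : 0 <= Hbar Phi x.
Proof. by have /andP[] := hH0 x; exact: le_trans. Qed.

(** The square root of [Phi] is positive at the neighbours, so its Laplacian exceeds -2d times its
    value. *)
Lemma Hbar_lt x : Hbar Phi x < 2 * d%:R.
Proof.
rewrite -(ltr_pM2r (Pb_gt0 x 2^-1)) HbarE laplacianE opprB ltrBlDr ltrDl.
pose k := Ordinal d_gt0.
apply: (lt_le_trans (Pb_gt0 (x + dirvec k) 2^-1)).
apply: (@le_nsum _ _ (fun y => Phi y `^ 2^-1)) => [y _|]; first exact: ltW.
by apply/adjP; exists k; left.
Qed.

(** The square root lies below its tangent at [Phi 0], so its Laplacian at 0 is at most a positive
    multiple of that of [Phi], which is -1. *)
Lemma Hbar0_gt0 : 0 < Hbar Phi 0.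
Proof.
rewrite -(pmulr_lgt0 _ (Pb_gt0 0 2^-1)) HbarE oppr_gt0 laplacian_nsum.
have s0 : 0 < Phi 0 `^ 2^-1 by [].
have sq y : (Phi y `^ 2^-1) ^+ 2 = Phi y by rewrite powR12_sqrt // sqr_sqrtr.
apply: (@le_lt_trans _ _ (nsum (fun y => (2 * Phi 0 `^ 2^-1)^-1 * (Phi y - Phi 0)) 0)).
  apply: ler_nsum => y _; rewrite ler_pdivlMl ?mulr_gt0 //.
  rewrite -[in leRHS](sq y) -[in leRHS](sq 0).
  by have := sqr_ge0 (Phi y `^ 2^-1 - Phi 0 `^ 2^-1); lra.
rewrite nsumZ -laplacian_nsum (laplacian_Phi hPhi) eqxx mulrN1 oppr_lt0.
by rewrite invr_gt0 mulr_gt0.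
Qed.

(** This is the diagonal coefficient of the operator, by which [picard] divides. *)
Lemma potential_gt0 mu x : -1 <= mu -> 0 < 2 * d%:R + mu * H0 x.
Proof.
by move=> mu1; have := Hbar_lt x; have /andP[] := hH0 x; nra.
Qed.

Lemma near_weight (e a : R) : 0 < a -> 0 < e ->
  \forall x \near at_infinity R d, weight R x `^ (- a) < e.
Proof.
move=> a0 e0; have [M HM] := powRN_small a0 e0.
have := near_enorm d M; apply: filterS => x Mx; apply: HM.
by rewrite /weight; lra.
Qed.

(* [Phi] is harmonic away from 0, so the first-order Taylor terms cancel and only the
   sum of squared relative increments of [Phi] remains; it is eliminated in favour of
   [Hbar], which is the case [b = 1/2]. Hence no lower bound on [Hbar] is needed. *)
Lemma laplacian_Phi_powR (B : R) : 0 <= B -> exists2 K : R, 0 < K &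
  \forall x \near at_infinity R d, forall b, `|b| <= B ->
    `|laplacian (fun y => Phi y `^ b) x - 4 * b * (b - 1) * Hbar Phi x * Phi x `^ b|
    <= K * weight R x `^ (- 2^-1) * Hbar Phi x * Phi x `^ b.
Proof.
move=> B0; have [C C0 HC] := Phi_rel_grad hd hPhi.
(* The bound [B + 1] also admits the exponent 1/2, which produces [Hbar]. *)
have B1 : 0 <= B + 1 by lra.
have [K K0 HK] := @laplacian_powR R (B + 1) B1.
pose K' := 16 * (K * C) * (1 + 4 * (B * (B + 1))).
have BB : 0 <= B * (B + 1) by rewrite mulr_ge0.
exists K'; first by rewrite !mulr_gt0 //; lra.
near=> x => b bB; pose w := weight R x `^ (- 2^-1); rewrite -/w.
have w0 : 0 < w by rewrite powR_gt0 // weight_gt0.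
have w1 : w < (2 * C)^-1.
  by rewrite /w; near: x; apply: near_weight; rewrite ?invr_gt0 ?mulr_gt0.
have w2 : w < (16 * (K * C))^-1.
  by rewrite /w; near: x; apply: near_weight; rewrite ?invr_gt0 ?mulr_gt0.
have x0 : x != 0 by near: x; exact: near_neq0.
have tau2 : C * w <= 2^-1.
  by move: w1; rewrite invfM -ltr_pdivrMr ?invr_gt0 // invrK => /ltW; rewrite mulrC.
have Kw : K * C * w <= 16^-1.
  have KC : 0 < K * C by rewrite mulr_gt0.
  by move: w2; rewrite invfM -ltr_pdivrMr ?invr_gt0 // invrK => /ltW; rewrite mulrC.
have lap b' : `|b'| <= B + 1 ->
    `|laplacian (fun y => Phi y `^ b') x - Phi x `^ b' * (b' * (b' - 1) / 2 *
      nsum (fun y => ((Phi y - Phi x) / Phi x) ^+ 2) x)| <=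
    K * (C * w) * nsum (fun y => ((Phi y - Phi x) / Phi x) ^+ 2) x * Phi x `^ b'.
  move=> /(HK d Phi x (C * w) b' (P_gt0 x) tau2 (HC x)).
  by rewrite (laplacian_Phi hPhi) (negbTE x0) oppr0 mul0r mulr0 add0r.
have := lap b (le_trans bB _); have := lap 2^-1.
rewrite gtr0_norm //; set Q := nsum _ x.
have Q0 : 0 <= Q by apply: nsum_ge0 => y _; exact: sqr_ge0.
set L := laplacian _ x; set Lb := laplacian _ x => Hhalf Hb.
have {}Hhalf : `|Hbar Phi x - Q / 8| <= K * C * w * Q.
  rewrite -(ler_pM2r (Pb_gt0 x 2^-1)) -[X in _ * X <= _](gtr0_norm (Pb_gt0 x 2^-1)) -normrM.
  rewrite mulrBl HbarE -/L -normrN opprB.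
  have h1 : 2^-1 <= B + 1 by lra.
  apply: le_trans (le_trans (Hhalf h1) _); last by rewrite mulrA.
  by rewrite le_eqVlt; apply/orP; left; apply/eqP; congr (`|_|); field.
(* The error is at most half of the main term [Q / 8], so the estimate can be turned around to
   control [Q] by [Hbar]. *)
have QH : Q <= 16 * Hbar Phi x.
  have : K * C * w * Q <= 16^-1 * Q by rewrite ler_wpM2r.
  by move: Hhalf; rewrite ler_norml => /andP[]; lra.
have h2 : B <= B + 1 by lra.
have bb : `|4 * b * (b - 1)| <= 4 * (B * (B + 1)).
  rewrite -mulrA normrM gtr0_norm // ler_pM2l // normrM ler_pM //.
  by apply: le_trans (ler_normB _ _) _; rewrite normr1 lerD2r.
rewrite (_ : _ - _ = (Lb - Phi x `^ b * (b * (b - 1) / 2 * Q))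
  - 4 * b * (b - 1) * (Hbar Phi x - Q / 8) * Phi x `^ b); last by field.
apply: le_trans (ler_normB _ _) _.
apply: le_trans (lerD (Hb h2) (_ : _ <= 4 * (B * (B + 1)) * (K * C * w * Q) * Phi x `^ b)) _.
  rewrite normrM (gtr0_norm (Pb_gt0 x b)) ler_pM2r // normrM ler_pM //.
rewrite (_ : K * (C * w) * Q * _ + _ =
  K * C * w * Q * (1 + 4 * (B * (B + 1))) * Phi x `^ b); last by ring.
rewrite ler_pM2r // (_ : K' * w * _ = K * C * w * (16 * Hbar Phi x) * (1 + 4 * (B * (B + 1)))).
  by rewrite ler_wpM2r ?ler_wpM2l ?mulr_ge0 ?(ltW C0) ?(ltW K0) ?(ltW w0) //; lra.
by rewrite /K'; ring.
Unshelve. all: by end_near. Qed.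

Hypothesis hlim : exists eps0 : R, 0 < eps0 < 1 /\
  (0 <= limsup_at_infinity
          (fun x => ((Hbar Phi x - H0 x) * enorm R x `^ eps0
                       / Hbar Phi x)%:E) < +oo)%E.

Lemma H0_close : exists e : R, 0 < e /\ exists2 K : R, 0 < K &
  \forall x \near at_infinity R d,
    Hbar Phi x - H0 x <= K * weight R x `^ (- e) * Hbar Phi x.
Proof.
have [e [/andP[e0 e1] /andP[_]]] := hlim.
move=> /ereal_inf_lt[_ [V VF <-] supV]; exists e; split => //.
pose s := ereal_sup [set ((Hbar Phi x - H0 x) * enorm R x `^ e / Hbar Phi x)%:E | x in V].
pose K := Num.max 1 (fine s).
have K1 : 1 <= K by rewrite le_max lexx.
exists (2 * K); first by lra.
near=> x.
have Vx : V x by near: x.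
have x1 : 1 < enorm R x by near: x; exact: near_enorm.
(* Where [Hbar] is 0 the quotient defaults to 0 and says nothing; there [H0 >= 0] suffices. *)
have [Hz|Hp] := eqVneq (Hbar Phi x) 0.
  by have /andP[] := hH0 x; rewrite Hz; lra.
have {}Hp : 0 < Hbar Phi x by rewrite lt_neqAle eq_sym Hp Hbar_ge0.
set t := (Hbar Phi x - H0 x) * enorm R x `^ e / Hbar Phi x.
have ts : (t%:E <= s)%E by apply: ereal_sup_ubound; exists x.
have tK : t <= K.
  have sfin : s \is a fin_num.
    by rewrite fin_real // (lt_le_trans _ ts) ?ltNyr.
  rewrite le_max; apply/orP; right.
  by rewrite -lee_fin fineK.
(* Beyond radius 1 the weight is at most twice the norm, and 2^e <= 2 because [e < 1]. *)
have W : enorm R x `^ (- e) <= 2 * weight R x `^ (- e).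
  have w0 := weight_gt0 R x.
  have xp : 0 < enorm R x by lra.
  apply: (@le_trans _ _ (2 `^ e * weight R x `^ (- e))); last first.
    rewrite ler_wpM2r ?powR_ge0 //; apply: ler1_powR => //; lra.
  rewrite !powRN ler_pdivlMr ?powR_gt0 // ler_pdivrMl ?powR_gt0 // mulrC -powRM ?(ltW xp) //.
  by apply: ler_powRl; rewrite ?(ltW e0) ?(ltW w0) // /weight; lra.
have -> : Hbar Phi x - H0 x = t * enorm R x `^ (- e) * Hbar Phi x.
  by rewrite powRN /t; field; rewrite !gt_eqF // powR_gt0 //; lra.
rewrite ler_pM2r // [2 * K]mulrC.
apply: (@le_trans _ _ (K * enorm R x `^ (- e))); first by rewrite ler_wpM2r ?powR_ge0.
by rewrite -mulrA ler_wpM2l //; lra.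
Unshelve. all: by end_near. Qed.

Lemma weight_le_powR x (a e : R) : a <= e -> weight R x `^ (- e) <= weight R x `^ (- a).
Proof. by move=> ae; apply: ler_powR; rewrite ?weight_ge1 // lerN2. Qed.

(** The coefficient of the main term vanishes at [alpha mu]. The rate [r] reflects the slower of two
    decays, that of the increments of [Phi] and that of [Hbar - H0]; it is fixed before [B], so
    exponents such as [alpha mu + r] are allowed. *)
Lemma hardy_Phi_powR mu : exists2 r : R, 0 < r & forall B : R, 0 <= B ->
  exists2 K : R, 0 < K & \forall x \near at_infinity R d, forall b, `|b| <= B ->
    `|hardy_op H0 mu (fun y => Phi y `^ b) x
       - (mu - 4 * b * (b - 1)) * Hbar Phi x * Phi x `^ b|
    <= K * Phi x `^ r * Hbar Phi x * Phi x `^ b.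
Proof.
have [e [e0 [K1 K10 HK1]]] := H0_close.
pose a := Num.min 2^-1 e.
have a0 : 0 < a by rewrite lt_min e0 invr_gt0 ltr0n.
have [C C0 HC] := weight_powR_le_Phi hd hPhi a0.
exists (a / (d%:R - 2)).
  by rewrite divr_gt0 // subr_gt0 ltr_nat.
move=> B B0; have [K2 K20 HK2] := laplacian_Phi_powR B0.
exists ((K2 + `|mu| * K1) * C).
  by rewrite mulr_gt0 // ltr_wpDr ?mulr_ge0 ?(ltW K10).
apply: filterS2 HK1 HK2 => x H1 H2 b bB.
have {H2} := H2 b bB; set L := laplacian _ x => H2.
set w := weight R x `^ (- a).
have w0 : 0 <= w by exact: powR_ge0.
have HH := Hbar_ge0 x; have Pp := Pb_gt0 x b.
have {}H2 : `|L - 4 * b * (b - 1) * Hbar Phi x * Phi x `^ b| <= K2 * w * Hbar Phi x * Phi x `^ b.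
  apply: le_trans H2 _; rewrite ler_pM2r // ler_wpM2r // ler_pM2l //.
  by apply: weight_le_powR; rewrite ge_min lexx.
have H3 : `|Hbar Phi x - H0 x| <= K1 * w * Hbar Phi x.
  rewrite ger0_norm; last by have /andP[] := hH0 x; rewrite subr_ge0.
  apply: le_trans H1 _; rewrite ler_wpM2r // ler_pM2l //.
  by apply: weight_le_powR; rewrite ge_min lexx orbT.
rewrite /hardy_op -/L (_ : _ - _ = - (L - 4 * b * (b - 1) * Hbar Phi x * Phi x `^ b)
   - mu * (Hbar Phi x - H0 x) * Phi x `^ b); last by ring.
apply: le_trans (ler_normB _ _) _; rewrite normrN.
apply: le_trans (lerD H2 (_ : _ <= `|mu| * (K1 * w * Hbar Phi x) * Phi x `^ b)) _.
  by rewrite !normrM (gtr0_norm Pp) ler_pM2r // ler_wpM2l.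
rewrite (_ : K2 * w * _ * _ + _ = (K2 + `|mu| * K1) * w * Hbar Phi x * Phi x `^ b); last by ring.
rewrite ler_pM2r // ler_wpM2r // -[leRHS]mulrA ler_wpM2l //.
  by rewrite addr_ge0 ?mulr_ge0 ?(ltW K10) ?(ltW K20).
exact: HC.
Qed.

End Hardy.

(** * Summation by parts and infinite sums *)

Section Sums.
Variables (R : realType) (d : nat) (H0 : lattice d -> R) (mu : R).
Implicit Types (x y : lattice d) (s : seq (lattice d)) (u phi : lattice d -> R).

Lemma hardyE u x :
  hardy_op H0 mu u x = (2 * d%:R + mu * H0 x) * u x - nsum u x.
Proof. by rewrite /hardy_op laplacianE; ring. Qed.

Lemma hardyD u v x :
  hardy_op H0 mu (fun y => u y + v y) x = hardy_op H0 mu u x + hardy_op H0 mu v x.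
Proof. by rewrite !hardyE nsumD; ring. Qed.

Lemma hardyB u v x :
  hardy_op H0 mu (fun y => u y - v y) x = hardy_op H0 mu u x - hardy_op H0 mu v x.
Proof. by rewrite !hardyE nsumB; ring. Qed.

Lemma hardyZ a u x :
  hardy_op H0 mu (fun y => a * u y) x = a * hardy_op H0 mu u x.
Proof. by rewrite !hardyE nsumZ; ring. Qed.

Lemma nsum_seq u x s : uniq s -> (forall y, adj x y -> y \notin s -> u y = 0) ->
  nsum u x = \sum_(y <- s | adj x y) u y.
Proof. by move=> us h; rewrite nsumE; apply/esym/bigfs. Qed.

(** Including the neighbours of the support removes the boundary terms from [sum_by_parts]. *)
Definition closing phi s : Prop :=
  uniq s /\ forall x, phi x != 0 -> x \in s /\ forall y, adj x y -> y \in s.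

Lemma closingP phi (A : set (lattice d)) :
  finite_set [set x | phi x != 0] -> finite_set A ->
  exists2 s, closing phi s & forall x, A x -> x \in s.
Proof.
move=> fs fA.
pose B := [set x | phi x != 0] `|` A `|`
  \bigcup_(x in [set x | phi x != 0]) [set y | adj x y].
have : finite_set B.
  rewrite /B !finite_setU; split; first by split.
  by apply: bigcup_finite => // x _; exact: finite_neighbors.
move=> /finite_seqP[s sB]; exists (undup s).
  split; first exact: undup_uniq.
  move=> x px; have inB y : B y -> y \in undup s by rewrite sB mem_undup.
  by split => [|y xy]; apply: inB; [left; left|right; exists x].
by move=> x Ax; rewrite mem_undup; have : B x by [left; right]; rewrite sB.
Qed.

(** Adjacency is symmetric, so the double sum over adjacent pairs in [s] can be exchanged; [u] may
    have any support. *)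
Lemma sum_by_parts phi u s : closing phi s ->
  \sum_(x <- s) phi x * hardy_op H0 mu u x = \sum_(x <- s) u x * hardy_op H0 mu phi x.
Proof.
move=> [us cl].
under eq_bigr do rewrite hardyE mulrBr mulrCA.
under [RHS]eq_bigr do rewrite hardyE mulrBr mulrCA [u _ * phi _]mulrC.
rewrite !sumrB; congr (_ - _).
transitivity (\sum_(x <- s) \sum_(y <- s | adj x y) phi x * u y).
  apply: eq_bigr => x _; have [->|px] := eqVneq (phi x) 0.
    by rewrite mul0r big1 // => y _; rewrite mul0r.
  rewrite -mulr_sumr; congr (_ * _); apply: nsum_seq => // y xy.
  by rewrite (proj2 (cl x px) y xy).
transitivity (\sum_(y <- s) \sum_(x <- s | adj y x) u y * phi x).
  under eq_bigr do rewrite big_mkcond.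
  rewrite exchange_big /=; apply: eq_bigr => y _; rewrite [RHS]big_mkcond.
  by apply: eq_bigr => x _; rewrite adj_sym mulrC.
apply: eq_bigr => x _; rewrite -mulr_sumr; congr (_ * _); apply/esym/nsum_seq => // y xy ys.
by apply/eqP; apply: contraNT ys => py; case: (cl y py).
Qed.

Variable (f : lattice d -> R).
Hypothesis f0 : forall x, 0 <= f x.

Lemma sum_le_esum s : uniq s ->
  ((\sum_(x <- s) f x)%:E <= \esum_(x in [set: lattice d]) (f x)%:E)%E.
Proof.
move=> us; apply: esum_ge; exists [set` s]; first by split => //; exact: finite_seq.
by rewrite -sumEFin fsbig_seq.
Qed.

Lemma esum_finite_bound : (\esum_(x in [set: lattice d]) (f x)%:E < +oo)%E ->
  exists2 S : R, 0 <= S & forall s, uniq s -> \sum_(x <- s) f x <= S.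
Proof.
move=> lt; have ge : (0 <= \esum_(x in [set: lattice d]) (f x)%:E)%E.
  by apply: esum_ge0 => x _; rewrite lee_fin.
have fin : \esum_(x in [set: lattice d]) (f x)%:E \is a fin_num by rewrite ge0_fin_numE.
exists (fine (\esum_(x in [set: lattice d]) (f x)%:E)) => [|s us]; first exact: fine_ge0.
by rewrite -lee_fin fineK //; exact: sum_le_esum.
Qed.

Lemma esum_infinite_exceeds (M : R) :
  \esum_(x in [set: lattice d]) (f x)%:E = +oo%E ->
  exists2 s, uniq s & M < \sum_(x <- s) f x.
Proof.
move=> inf; have : (M%:E < \esum_(x in [set: lattice d]) (f x)%:E)%E by rewrite inf ltry.
move=> /ereal_sup_gt[_ [A [fA _] <-]].
move: fA => /finite_seqP[s ->]; rewrite -(_ : [set` undup s] = [set` s]); last first.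
  by apply/seteqP; split => x /=; rewrite mem_undup.
rewrite -fsbig_seq ?undup_uniq // sumEFin lte_fin => h.
by exists (undup s) => //; exact: undup_uniq.
Qed.

End Sums.

(** * Monotone iteration towards the minimal solution *)

Section Existence.
Variables (R : realType) (d : nat) (H0 g G : lattice d -> R) (mu : R) (x0 : lattice d) (S : R).
Implicit Types (x y : lattice d) (n : nat).
Let D x : R := 2 * d%:R + mu * H0 x.
Hypothesis D_gt0 : forall x, 0 < D x.
Hypothesis g_ge0 : forall x, 0 <= g x.
Hypothesis G_ge0 : forall x, 0 <= G x.
Hypothesis G_super : forall x, 0 <= hardy_op H0 mu G x.
Hypothesis G_x0 : 0 < hardy_op H0 mu G x0.
Hypothesis GgS : forall s : seq (lattice d), uniq s -> \sum_(x <- s) G x * g x <= S.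

(** Fixed-point iteration for [D x * u x = g x + nsum u x], cut off outside a growing ball so that
    each iterate has finite support and can be paired with [G]. *)
Fixpoint picard n : lattice d -> R :=
  if n is m.+1 then fun x =>
    if enorm R x <= m%:R then (g x + nsum (picard m) x) / D x else 0
  else fun=> 0.

Lemma picard_ge0 n x : 0 <= picard n x.
Proof.
elim: n x => //= n IH x; case: ifP => // _.
by rewrite divr_ge0 ?(ltW (D_gt0 x)) // addr_ge0 // nsum_ge0.
Qed.

Lemma picard_mono n x : picard n x <= picard n.+1 x.
Proof.
elim: n x => [|n IH] x; first exact: (picard_ge0 1).
rewrite [leLHS]/= [leRHS]/=; case: ifP => xn; last first.
  by case: ifP => // _; rewrite divr_ge0 ?(ltW (D_gt0 x)) // addr_ge0 // nsum_ge0 // => y _;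
    exact: (picard_ge0 n.+1).
rewrite (le_trans xn) ?ler_nat // ler_pM2r ?invr_gt0 // lerD2l.
by apply: ler_nsum => y _; exact: IH.
Qed.

(** Inside the ball, monotonicity replaces the previous iterate by the current one in the neighbour
    sum; outside, the value 0 leaves only a nonpositive term. *)
Lemma picard_sub n x : hardy_op H0 mu (picard n) x <= g x.
Proof.
rewrite hardyE -/(D x); case: n => [|n].
  by rewrite mulr0 /nsum big1 ?subr0 // => k _ /=; rewrite addr0.
rewrite lerBlDr [picard n.+1 x]/=; case: ifP => _; last first.
  by rewrite mulr0 addr_ge0 // nsum_ge0 // => y _; exact: picard_ge0.
rewrite mulrC divfK ?gt_eqF // lerD2l; apply: ler_nsum => y _; exact: picard_mono.
Qed.

Lemma picard_le_solution n u : poisson_solution H0 mu g u -> forall x, picard n x <= u x.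
Proof.
move=> [Lu u0]; elim: n => [|n IH] x //=; case: ifP => // _.
rewrite ler_pdivrMr //; have := Lu x; rewrite hardyE -/(D x) => /eqP; rewrite subr_eq => /eqP.
by rewrite mulrC => ->; rewrite lerD2l; apply: ler_nsum => y _; exact: IH.
Qed.

Lemma picard_finite n : finite_set [set x | picard n x != 0].
Proof.
apply: (@sub_finite_set _ _ [set x | enorm R x <= n%:R]); last exact: finite_ball.
case: n => [|n] x /=; first by rewrite eqxx.
by case: ifP => [xn _|]; [rewrite (le_trans xn) // ler_nat|rewrite eqxx].
Qed.

(** At [x0], summation by parts against [G] bounds the iterates by [S] over the operator value
    there. The bound passes to neighbours because each iterate is dominated there by [D x] times the
    next one at [x]. *)
Lemma picard_bounded x : exists K : R, forall n, picard n x <= K.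
Proof.
move: x; apply: (@adj_ind _ _ x0) => [|x y xy [K HK]].
  exists (S / hardy_op H0 mu G x0) => n; rewrite ler_pdivlMr //.
  have [s cs sx0] := closingP (picard_finite n) (finite_set1 x0).
  have us : uniq s by case: cs.
  apply: le_trans (GgS us).
  apply: (@le_trans _ _ (\sum_(x <- s) picard n x * hardy_op H0 mu G x)).
    rewrite (big_rem x0) /=; last exact: sx0.
    by rewrite lerDl sumr_ge0 // => x _; rewrite mulr_ge0 ?picard_ge0.
  rewrite sum_by_parts //; apply: ler_sum => x _.
  by rewrite ler_wpM2l // picard_sub.
(* From index [N] on, [x] lies in the cutoff ball; smaller indices follow by monotonicity. *)
pose N := (Num.truncn (enorm R x)).+1.
have mono m n : (m <= n)%N -> picard m y <= picard n y.
  elim: n => [|n IH]; first by rewrite leqn0 => /eqP ->.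
  rewrite leq_eqVlt => /orP[/eqP -> //|]; rewrite ltnS => /IH h.
  exact: le_trans h (picard_mono _ _).
exists (D x * K) => n; apply: (@le_trans _ _ (picard (n + N) y)).
  by apply: mono; rewrite leq_addr.
have := HK (n + N).+1; rewrite /= ifT; last first.
  rewrite (@le_trans _ _ N%:R) ?ler_nat ?leq_addl //; apply: ltW; exact: truncnS_gt.
rewrite ler_pdivrMr // mulrC => h; apply: le_trans h.
rewrite -[leLHS]add0r lerD //.
by apply: (@le_nsum _ _ (picard (n + N))) => // z _; exact: picard_ge0.
Qed.

(** Neighbour sums are finite, so the recursion passes to the limit; minimality holds because every
    iterate lies below every solution. *)
Lemma exists_minimal_solution : exists v, minimal_poisson_solution H0 mu g v.
Proof.
have cv x : cvgn (fun n => picard n x).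
  apply: nondecreasing_is_cvgn.
    by apply/nondecreasing_seqP => n; exact: picard_mono.
  have [K HK] := picard_bounded x; exists K => _ [n _ <-]; exact: HK.
exists (fun x => limn (fun n => picard n x)); split; last first.
  move=> u Hu x; apply: limr_le => //; apply: nearW => n; exact: picard_le_solution.
split=> x; last first.
  by apply: limr_ge => //; apply: nearW => n; exact: picard_ge0.
set v : lattice d -> R := fun x => _.
have vS : (fun n => picard n.+1 x) @ \oo --> v x.
  rewrite (@cvg_shiftS _ (fun n => picard n x)); exact: cv.
have nv : (fun n => nsum (picard n) x) @ \oo --> nsum v x.
  apply: cvg_big => [|k _]; first exact: add_continuous.
  by apply: cvgD; exact: cv.
have vS2 : (fun n => picard n.+1 x) @ \oo --> (g x + nsum v x) / D x.
  apply: cvg_trans (_ : (fun n => (g x + nsum (picard n) x) / D x) @ \oo --> _); last first.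
    by apply: cvgM; [apply: cvgD => //|]; exact: cvg_cst.
  apply: near_eq_cvg; near=> n; rewrite /= ifT //.
  near: n; exact: nbhs_infty_ger.
have e : v x = (g x + nsum v x) / D x.
  by apply: (cvg_unique _ vS vS2); exact: norm_hausdorff.
rewrite hardyE -/(D x) e mulrC divfK ?gt_eqF //; ring.
Unshelve. all: by end_near. Qed.

End Existence.

(** * Supersolutions and existence when the weighted sum is finite *)

Section HardyPoisson.
Variables (R : realType) (d : nat) (Phi H0 : lattice d -> R).
Hypothesis hd : (3 <= d)%N.
Hypothesis hPhi : fundamental_solution Phi.
Hypothesis hH0 : forall x, 0 <= H0 x <= Hbar Phi x.
Hypothesis hlim : exists eps0 : R, 0 < eps0 < 1 /\
  (0 <= limsup_at_infinity
          (fun x => ((Hbar Phi x - H0 x) * enorm R x `^ eps0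
                       / Hbar Phi x)%:E) < +oo)%E.
Implicit Types (x y : lattice d) (u v : lattice d -> R) (mu b : R).

Let d_gt0 : (0 < d)%N := leq_trans (isT : (0 < 3)%N) hd.
Let P_gt0 x : 0 < Phi x := Phi_gt0 hd hPhi x.
Let P_ge0 x : 0 <= Phi x := ltW (P_gt0 x).
Let Pb_gt0 x b : 0 < Phi x `^ b. Proof. exact: powR_gt0. Qed.
Let Hb_ge0 := Hbar_ge0 hH0.

Definition alpha mu : R := (1 + Num.sqrt (1 + mu)) / 2.

Lemma alpha_root mu : -1 <= mu -> 4 * alpha mu * (alpha mu - 1) = mu.
Proof.
move=> mu1; have : Num.sqrt (1 + mu) ^+ 2 = 1 + mu by rewrite sqr_sqrtr //; lra.
rewrite /alpha; move: (Num.sqrt _) => s h.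
by rewrite (_ : mu = s ^+ 2 - 1); [field|lra].
Qed.

Lemma alpha_ge_half mu : 2^-1 <= alpha mu.
Proof. by rewrite /alpha; have := sqrtr_ge0 (1 + mu); lra. Qed.

Lemma weight_Phi_alpha mu : exists2 C : R, 0 < C & forall x,
  Phi x `^ alpha mu <= C * weight R x `^ tau_minus d mu /\
  weight R x `^ tau_minus d mu <= C * Phi x `^ alpha mu.
Proof.
have a0 : 0 <= alpha mu by have := alpha_ge_half mu; lra.
have [C C0 HC] := Phi_le_weight hd hPhi; have [c c0 Hc] := Phi_ge_weight hd hPhi.
exists (C `^ alpha mu + c^-1 `^ alpha mu) => [|x]; first by rewrite addr_gt0 ?powR_gt0 ?invr_gt0.
have -> : tau_minus d mu = (2 - d%:R) * alpha mu by rewrite /tau_minus /alpha; field.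
rewrite [weight R x `^ _]powRrM; set W := weight R x `^ (2 - d%:R).
have W0 : 0 <= W := powR_ge0 _ _.
split.
  apply: le_trans (_ : C `^ alpha mu * W `^ alpha mu <= _).
    by rewrite -powRM ?(ltW C0) //; apply: ler_powRl.
  by rewrite ler_wpM2r ?powR_ge0 // lerDl powR_ge0.
apply: le_trans (_ : c^-1 `^ alpha mu * Phi x `^ alpha mu <= _).
  rewrite -powRM ?invr_ge0 ?(ltW c0) //; apply: ler_powRl => //.
  by rewrite ler_pdivlMl //; exact: Hc.
by rewrite ler_wpM2r ?powR_ge0 // lerDr powR_ge0.
Qed.

Lemma near_Phi_powR (a e : R) : 0 < a -> 0 < e ->
  \forall x \near at_infinity R d, Phi x `^ a < e.
Proof.
move=> a0 e0; have := near_Phi hPhi (powR_gt0 a^-1 e0).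
apply: filterS => x; rewrite gtr0_norm // => h.
rewrite -[ltRHS]powRr1 ?(ltW e0) // -(mulVf (lt0r_neq0 a0)) powRrM.
by apply: gt0_ltr_powR => //; rewrite nnegrE ?powR_ge0.
Qed.

Lemma hardy_sqrt_Phi mu x :
  hardy_op H0 mu (fun y => Phi y `^ 2^-1) x = (Hbar Phi x + mu * H0 x) * Phi x `^ 2^-1.
Proof. by rewrite /hardy_op -(HbarE hd hPhi) mulrDl. Qed.

Lemma Hbar_potential_ge0 mu x : -1 <= mu -> 0 <= Hbar Phi x + mu * H0 x.
Proof. by move=> mu1; have /andP[] := hH0 x; nra. Qed.

Lemma hardy_sqrt_Phi_ge0 mu x : -1 <= mu ->
  0 <= hardy_op H0 mu (fun y => Phi y `^ 2^-1) x.
Proof. by move=> mu1; rewrite hardy_sqrt_Phi mulr_ge0 ?powR_ge0 ?Hbar_potential_ge0. Qed.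

(** The minimum keeps the value at [x] and can only lower the neighbours. *)
Lemma hardy_min mu u v x : u x <= v x ->
  hardy_op H0 mu u x <= hardy_op H0 mu (fun y => Num.min (u y) (v y)) x.
Proof.
move=> uv; rewrite !hardyE (min_l uv) lerD2l lerN2; apply: ler_nsum => y _.
by rewrite ge_min lexx.
Qed.

(** The correction in [psi] beats the error, so [psi] is a supersolution off a finite set. On that
    set a small multiple of Phi^(1/2), a supersolution everywhere, lies below [psi]; the minimum of
    the two is then a global supersolution. *)
Lemma supersolution_gt mu : -1 < mu -> exists G, [/\ forall x, 0 <= G x,
   forall x, 0 <= hardy_op H0 mu G x, 0 < hardy_op H0 mu G 0 &
   forall x, G x <= Phi x `^ alpha mu].
Proof.
move=> mu1; set al := alpha mu; have al1 := alpha_ge_half mu; rewrite -/al in al1.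
have [r r0 Hr] := hardy_Phi_powR hd hPhi hH0 hlim mu.
have [K K0 HK] := Hr (al + r) ltac:(lra).
have [M M0 HM] := Phi_bounded hd hPhi.
(* Since [M] bounds [Phi], the correction is at most half of the main term. *)
pose eta := (2 * M `^ (r / 2))^-1.
have eta0 : 0 < eta by rewrite invr_gt0 mulr_gt0 // powR_gt0.
pose psi x := Phi x `^ al - eta * Phi x `^ (al + r / 2).
have psiE x : psi x = Phi x `^ al * (1 - eta * Phi x `^ (r / 2)).
  by rewrite /psi (PhiD hd hPhi); ring.
have eP x : eta * Phi x `^ (r / 2) <= 2^-1.
  rewrite /eta invfM -mulrA ler_piMr ?invr_ge0 // ler_pdivrMl ?powR_gt0 // mulr1.
  by apply: ler_powRl => //; lra.
have psi0 x : 0 < psi x by rewrite psiE mulr_gt0 //; have := eP x; lra.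
have psi_le x : psi x <= Phi x `^ al.
  by rewrite /psi gerBl mulr_ge0 ?(ltW eta0) ?powR_ge0.
have psi_near : \forall x \near at_infinity R d, 0 <= hardy_op H0 mu psi x.
  near=> x.
  have tK : Phi x `^ (r / 2) < eta * r ^+ 2 / (K * (1 + eta)).
    near: x; apply: near_Phi_powR; first lra.
    by rewrite divr_gt0 ?mulr_gt0 ?exprn_gt0 //; lra.
  have t1 : Phi x `^ (r / 2) < 1 by near: x; apply: near_Phi_powR; lra.
  have HKx : forall b, `|b| <= al + r -> `|hardy_op H0 mu (fun y => Phi y `^ b) x
       - (mu - 4 * b * (b - 1)) * Hbar Phi x * Phi x `^ b|
    <= K * Phi x `^ r * Hbar Phi x * Phi x `^ b by near: x.
  have := HKx (al + r / 2) ltac:(rewrite ger0_norm; lra).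
  have := HKx al ltac:(rewrite ger0_norm; lra).
  rewrite alpha_root; last exact: ltW.
  have -> : Phi x `^ r = Phi x `^ (r / 2) ^+ 2.
    by rewrite expr2 -(PhiD hd hPhi) -splitr.
  (* As [al] is a root and at least 1/2, this coefficient is at most [- r ^+ 2]; relative to Phi^al
     the gain is then of order [t], against an error of order [t ^+ 2]. *)
  have -> : mu - 4 * (al + r / 2) * (al + r / 2 - 1) = - (2 * r * (2 * al - 1) + r ^+ 2).
    by rewrite -[X in X - _](alpha_root (ltW mu1)) -/al; field.
  rewrite subrr !mul0r subr0 (PhiD hd hPhi).
  rewrite hardyB hardyZ; set L1 := hardy_op _ _ _ x; set L2 := hardy_op _ _ _ x.
  have P0 := Pb_gt0 x al; have t0 := Pb_gt0 x (r / 2); have Hx := Hb_ge0 x.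
  move: (Phi x `^ (r / 2)) (Phi x `^ al) (Hbar Phi x) P0 t0 Hx tK t1 => t P h P0 t0 Hx tK t1.
  rewrite !ler_norml => /andP[E1 _] /andP[_ E2].
  pose q := h * P * t; have q0 : 0 <= q by rewrite !mulr_ge0 ?(ltW P0) ?(ltW t0).
  have {}E1 : - (K * t * q) <= L1.
    by apply: le_trans E1; rewrite /q le_eqVlt; apply/orP; left; apply/eqP; ring.
  have {}E2 : L2 <= - (r ^+ 2 * q) + K * t * q.
    have c1 : r ^+ 2 * q <= (2 * r * (2 * al - 1) + r ^+ 2) * q.
      by rewrite ler_wpM2r // lerDr !mulr_ge0 ?(ltW r0) //; lra.
    have c2 : K * t ^+ 2 * q <= K * t * q.
      by rewrite ler_wpM2r // ler_pM2l // expr2 ler_piMr ?(ltW t0) ?(ltW t1).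
    have e1 : - (2 * r * (2 * al - 1) + r ^+ 2) * h * (P * t) =
        - ((2 * r * (2 * al - 1) + r ^+ 2) * q).
      by rewrite /q; ring.
    have e2 : K * t ^+ 2 * h * (P * t) = K * t ^+ 2 * q by rewrite /q; ring.
    by rewrite e1 e2 in E2; lra.
  have E3 : eta * L2 <= eta * (- (r ^+ 2 * q) + K * t * q) by rewrite ler_pM2l.
  have E4 : 0 <= (eta * r ^+ 2 - t * (K * (1 + eta))) * q.
    by rewrite mulr_ge0 // subr_ge0 -ler_pdivlMr ?(ltW tK) // mulr_gt0 //; lra.
  have e3 : (eta * r ^+ 2 - t * (K * (1 + eta))) * q =
      - (K * t * q) - eta * (- (r ^+ 2 * q) + K * t * q).
    by ring.
  by rewrite e3 in E4; lra.
have fin := near_finite psi_near.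
(* The point 0 is added so that the minimum is the multiple of Phi^(1/2) there, where the operator
   is strictly positive. *)
pose B := [set x | ~ 0 <= hardy_op H0 mu psi x] `|` [set 0].
have finB : finite_set B by rewrite finite_setU; split => //; exact: finite_set1.
have [A A0 HA] := finite_pos_min finB (fun x _ => divr_gt0 (psi0 x) (Pb_gt0 x 2^-1)).
pose u x := A * Phi x `^ 2^-1.
have u0 x : 0 < u x by rewrite mulr_gt0.
have Lu x : 0 <= hardy_op H0 mu u x.
  by rewrite hardyZ mulr_ge0 ?(ltW A0) // hardy_sqrt_Phi_ge0 // ltW.
have uB x : B x -> u x <= psi x by move=> /HA; rewrite ler_pdivlMr.
exists (fun x => Num.min (u x) (psi x)); split=> [x|x||x].
- by rewrite le_min !ltW.
- have [ux|ux] := leP (u x) (psi x); first exact: le_trans (Lu x) (hardy_min mu ux).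
  under eq_fun do rewrite minC.
  apply: le_trans (hardy_min mu (ltW ux)); apply: contrapT => h.
  by have := uB x (or_introl h); rewrite leNgt ux.
- apply: lt_le_trans (hardy_min mu (uB 0 (or_intror erefl))).
  rewrite hardyZ hardy_sqrt_Phi mulr_gt0 // mulr_gt0 //.
  have hb := Hbar0_gt0 hd hPhi; have /andP[h0 h1] := hH0 0.
  have [m0|m0] := leP 0 mu; first by have := mulr_ge0 m0 h0; lra.
  have : mu * Hbar Phi 0 <= mu * H0 0 by rewrite ler_nM2l.
  have : 0 < (1 + mu) * Hbar Phi 0 by rewrite mulr_gt0 //; lra.
  by lra.
- by rewrite ge_min psi_le orbT.
Unshelve. all: by end_near. Qed.

(** At [mu = -1] the exponent is 1/2 and Phi^(1/2) itself works; [H0 < Hbar] makes it strict at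
    0. *)
Lemma supersolution mu : -1 <= mu -> (mu = -1 -> forall x, H0 x < Hbar Phi x) ->
  exists G, [/\ forall x, 0 <= G x,
   forall x, 0 <= hardy_op H0 mu G x, 0 < hardy_op H0 mu G 0 &
   forall x, G x <= Phi x `^ alpha mu].
Proof.
rewrite le_eqVlt => /orP[/eqP <- /(_ erefl) H|mu1 _]; last exact: supersolution_gt.
exists (fun x => Phi x `^ 2^-1); split => [x|x||x].
- exact: ltW.
- exact: hardy_sqrt_Phi_ge0.
- by rewrite hardy_sqrt_Phi mulr_gt0 //; have := H 0; lra.
- by rewrite /alpha subrr sqrtr0 addr0 mul1r.
Qed.

Lemma minimal_solution_exists (g : lattice d -> R) mu : (forall x, 0 <= g x) ->
  -1 <= mu -> (mu = -1 -> forall x, H0 x < Hbar Phi x) ->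
  (weighted_sum mu g < +oo)%E -> exists v, minimal_poisson_solution H0 mu g v.
Proof.
move=> g0 mu1 muH fin.
have [G [G0 LG LG0 GP]] := supersolution mu1 muH.
have [C C0 HC] := weight_Phi_alpha mu.
have gw0 x : 0 <= g x * (1 + enorm R x) `^ tau_minus d mu by rewrite mulr_ge0 ?powR_ge0.
have [S S0 HS] := esum_finite_bound gw0 fin.
apply: (@exists_minimal_solution _ _ H0 g G mu 0 (C * S)) => // [x|s us].
  exact: (potential_gt0 hd hPhi hH0).
apply: le_trans (_ : C * \sum_(x <- s) g x * (1 + enorm R x) `^ tau_minus d mu <= _).
  rewrite mulr_sumr; apply: ler_sum => x _; rewrite mulrCA mulrC ler_wpM2l //.
  exact: le_trans (GP x) (proj1 (HC x)).
by rewrite ler_wpM2l ?(ltW C0) // HS.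
Qed.

(** * Nonexistence when the weighted sum diverges *)

Lemma hardy_max0_le mu v x : -1 <= mu ->
  hardy_op H0 mu (fun y => Num.max 0 (v y)) x <= Num.max 0 (hardy_op H0 mu v x).
Proof.
move=> mu1; rewrite le_max !hardyE; have [vx|vx] := leP (v x) 0.
  apply/orP; left; rewrite mulr0 sub0r oppr_le0 nsum_ge0 // => y _.
  by rewrite le_max lexx.
by apply/orP; right; rewrite lerD2l lerN2; apply: ler_nsum => y _; rewrite le_max lexx orbT.
Qed.

(** For [b >= alpha mu] the first coefficient is nonpositive and the second at most [- r ^+ 2],
    which absorbs both errors. Uniformity in [b] gives a single exceptional set for all test
    functions. *)
Lemma subsolution mu : -1 <= mu -> exists2 e : R, 0 < e &
  \forall x \near at_infinity R d, forall b, alpha mu <= b <= alpha mu + 1 ->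
    hardy_op H0 mu (fun y => Phi y `^ b + Phi y `^ (b + e)) x <= 0.
Proof.
move=> mu1; set al := alpha mu; have al1 := alpha_ge_half mu; rewrite -/al in al1.
have [r r0 Hr] := hardy_Phi_powR hd hPhi hH0 hlim mu.
have [K K0 HK] := Hr (al + 1 + r) ltac:(lra).
exists (r / 2); first lra.
near=> x => b /andP[b1 b2].
have tK : Phi x `^ (r / 2) < r ^+ 2 / (2 * K).
  by near: x; apply: near_Phi_powR; rewrite ?divr_gt0 ?mulr_gt0 ?exprn_gt0.
have t1 : Phi x `^ (r / 2) < 1 by near: x; apply: near_Phi_powR; lra.
have HKx : forall b, `|b| <= al + 1 + r -> `|hardy_op H0 mu (fun y => Phi y `^ b) x
     - (mu - 4 * b * (b - 1)) * Hbar Phi x * Phi x `^ b|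
  <= K * Phi x `^ r * Hbar Phi x * Phi x `^ b by near: x.
have := HKx (b + r / 2) ltac:(rewrite ger0_norm; lra).
have := HKx b ltac:(rewrite ger0_norm; lra).
have -> : Phi x `^ r = Phi x `^ (r / 2) ^+ 2.
  by rewrite expr2 -(PhiD hd hPhi) -splitr.
rewrite (PhiD hd hPhi) hardyD.
have m1 : mu - 4 * b * (b - 1) <= 0.
  rewrite -[X in X - _](alpha_root mu1) -/al.
  have -> : 4 * al * (al - 1) - 4 * b * (b - 1) = - (4 * (b - al) * (b + al - 1)) by ring.
  by rewrite oppr_le0 !mulr_ge0 //; lra.
have m2 : mu - 4 * (b + r / 2) * (b + r / 2 - 1) <= - r ^+ 2.
  have -> : mu - 4 * (b + r / 2) * (b + r / 2 - 1) =
    mu - 4 * b * (b - 1) - (2 * r * (2 * b - 1) + r ^+ 2) by field.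
  have : 0 <= 2 * r * (2 * b - 1) by rewrite !mulr_ge0 ?(ltW r0) //; lra.
  by lra.
move: (mu - _) (mu - _) m1 m2 => c2 c1 m1 m2.
set L1 := hardy_op _ _ _ x; set L2 := hardy_op _ _ _ x.
have P0 := Pb_gt0 x b; have t0 := Pb_gt0 x (r / 2); have Hx := Hb_ge0 x.
move: (Phi x `^ (r / 2)) (Phi x `^ b) (Hbar Phi x) P0 t0 Hx tK t1 => t P h P0 t0 Hx tK t1.
rewrite !ler_norml => /andP[_ E1] /andP[_ E2].
pose q := h * P * t; have q0 : 0 <= q by rewrite !mulr_ge0 ?(ltW P0) ?(ltW t0).
have {}E1 : L1 <= K * t * q.
  have e1 : K * t ^+ 2 * h * P = K * t * q by rewrite /q; ring.
  have : c1 * h * P <= 0 by rewrite -mulrA mulr_le0_ge0 // mulr_ge0 ?(ltW P0).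
  by rewrite e1 in E1; lra.
have {}E2 : L2 <= - (r ^+ 2) * q + K * t * q.
  have e2 : K * t ^+ 2 * h * (P * t) = K * t ^+ 2 * q by rewrite /q; ring.
  have e3 : c2 * h * (P * t) = c2 * q by rewrite /q; ring.
  have c3 : c2 * q <= - r ^+ 2 * q by rewrite ler_wpM2r.
  have c4 : K * t ^+ 2 * q <= K * t * q.
    by rewrite ler_wpM2r // ler_pM2l // expr2 ler_piMr ?(ltW t0) ?(ltW t1).
  by rewrite e2 e3 in E2; lra.
have E4 : 0 <= (r ^+ 2 - t * (2 * K)) * q.
  by rewrite mulr_ge0 // subr_ge0 -ler_pdivlMr ?(ltW tK) // mulr_gt0.
by rewrite mulrBl in E4; lra.
Unshelve. all: by end_near. Qed.

Lemma big_uniq_sub (s1 s2 : seq (lattice d)) (F : lattice d -> R) : uniq s1 -> uniq s2 ->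
  {subset s1 <= s2} -> \sum_(x <- s2 | x \in s1) F x = \sum_(x <- s1) F x.
Proof.
move=> u1 u2 sub; rewrite -big_filter; apply: perm_big; apply: uniq_perm => //.
  exact: filter_uniq.
by move=> x; rewrite mem_filter; case: (boolP (x \in s1)) => // /sub ->.
Qed.

Lemma no_solution_infinite (g : lattice d -> R) mu : (forall x, 0 <= g x) ->
  -1 <= mu -> weighted_sum mu g = +oo%E -> forall u, ~ poisson_solution H0 mu g u.
Proof.
move=> g0 mu1 inf u [Lu u0].
set al := alpha mu; have al1 := alpha_ge_half mu; rewrite -/al in al1.
have [e e0 sub] := subsolution mu1.
have [M M0 HM] := Phi_bounded hd hPhi.
pose M1 := Num.max 1 M; have M11 : 1 <= M1 by rewrite le_max lexx.
have HM1 x : Phi x <= M1 by rewrite le_max HM orbT.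
have /finite_seqP[sB sBE] := near_finite sub.
pose D x := 2 * d%:R + mu * H0 x.
have D0 x : 0 < D x := potential_gt0 hd hPhi hH0 x mu1.
pose T := 2 * M1 `^ (al + 1 + e).
have T0 : 0 < T by rewrite mulr_gt0 // powR_gt0; lra.
pose S := \sum_(x <- undup sB) u x * (D x * T).
(* The bound [S] is independent of [b], [eps] and [s1]: by summation by parts only points of [sB]
   contribute positively, and there the operator on [phi] is at most [D x * T]. *)
have bound (b eps : R) s1 : al < b -> b <= al + 1 -> 0 < eps -> uniq s1 ->
    \sum_(x <- s1) Num.max 0 (Phi x `^ b + Phi x `^ (b + e) - eps * Phi x `^ 2^-1) * g x <= S.
  move=> b1 b2 eps0 us1.
  pose v x := Phi x `^ b + Phi x `^ (b + e) - eps * Phi x `^ 2^-1.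
  pose phi x : R := Num.max 0 (v x).
  have phi0 x : 0 <= phi x by rewrite le_max lexx.
  have vT x : phi x <= T.
    rewrite ge_max (ltW T0) /=.
    have h c : 0 <= c -> c <= al + 1 + e -> Phi x `^ c <= M1 `^ (al + 1 + e).
      by move=> c0 cl; apply: le_trans (_ : M1 `^ c <= _); [exact: ler_powRl|exact: ler_powR].
    have := h b ltac:(lra) ltac:(lra); have := h (b + e) ltac:(lra) ltac:(lra).
    have := mulr_ge0 (ltW eps0) (ltW (Pb_gt0 x 2^-1)).
    by rewrite /v /T; lra.
  have fin : finite_set [set x | phi x != 0].
    apply: sub_finite_set (near_finite (_ : \forall x \near at_infinity R d, v x < 0)).
      by move=> x /= /eqP h vx; apply: h; rewrite /phi max_l // ltW.
    (* As [b > 1/2], Phi^(b - 1/2) tends to 0, so the [eps] term wins far out and [phi] has finite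
       support. *)
    pose E := 1 + M1 `^ e; have E0 : 0 < E by rewrite ltr_pwDl ?powR_ge0.
    have := @near_Phi_powR (b - 2^-1) (eps / E) ltac:(lra) (divr_gt0 eps0 E0).
    apply: filterS => x; rewrite ltr_pdivlMr // => h.
    have bE : Phi x `^ b = Phi x `^ (b - 2^-1) * Phi x `^ 2^-1.
      by rewrite -(PhiD hd hPhi) subrK.
    have -> : v x = (Phi x `^ (b - 2^-1) * (1 + Phi x `^ e) - eps) * Phi x `^ 2^-1.
      by rewrite /v (PhiD hd hPhi) bE; ring.
    rewrite pmulr_llt0 // subr_lt0; apply: le_lt_trans h.
    by rewrite ler_wpM2l ?powR_ge0 // lerD2l; apply: ler_powRl => //; exact: ltW.
  have Lphi x : hardy_op H0 mu phi x <= if x \in undup sB then D x * T else 0.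
    rewrite mem_undup; case: ifPn => [_|xB].
      rewrite hardyE -/(D x); apply: le_trans (_ : D x * phi x <= _).
        by rewrite gerBl nsum_ge0.
      by rewrite ler_pM2l.
    have sx : hardy_op H0 mu (fun y => Phi y `^ b + Phi y `^ (b + e)) x <= 0.
      have : ~ [set` sB] x by apply/negP.
      by rewrite -sBE /= => /contrapT; apply; rewrite -/al (ltW b1).
    apply: le_trans (hardy_max0_le v x mu1) _; rewrite ge_max lexx /=.
    rewrite hardyB hardyZ subr_le0; apply: le_trans sx _.
    by rewrite mulr_ge0 ?(ltW eps0) // hardy_sqrt_Phi_ge0.
  have [s cs sub1] := closingP fin (finite_seq (s1 ++ sB)).
  have us : uniq s by case: cs.
  apply: (@le_trans _ _ (\sum_(x <- s) phi x * g x)).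
    rewrite -(@big_uniq_sub s1 s) //; last by move=> x xs; apply: sub1; rewrite /= mem_cat xs.
    by rewrite [leRHS](bigID (mem s1)) /= lerDl sumr_ge0 // => x _; rewrite mulr_ge0.
  under eq_bigr do rewrite -Lu.
  rewrite sum_by_parts // /S -(@big_uniq_sub (undup sB) s) ?undup_uniq //; last first.
    by move=> x; rewrite mem_undup => xs; apply: sub1; rewrite /= mem_cat xs orbT.
  rewrite [leRHS]big_mkcond; apply: ler_sum => x _.
  by have := Lphi x; case: ifP => _ h; [rewrite ler_wpM2l|rewrite mulr_ge0_le0].
have [C C0 HC] := weight_Phi_alpha mu.
have gw0 x : 0 <= g x * (1 + enorm R x) `^ tau_minus d mu by rewrite mulr_ge0 ?powR_ge0.
have [s1 us1] := esum_infinite_exceeds (C * (4 * S)) inf.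
apply/negP; rewrite -leNgt.
have [m m0 Hm] := finite_pos_min (finite_seq s1) (fun x _ => P_gt0 x).
(* Chosen so that m^del >= 1/2, by exp t >= 1 + t, where [m] bounds [Phi] below on [s1]. *)
pose del := (2 * (1 + `|ln m|))^-1.
have del0 : 0 < del by rewrite invr_gt0 mulr_gt0 // ltr_pwDl.
have del1 : del <= 1.
  by rewrite invf_le1 ?mulr_gt0 ?ltr_pwDl //; have := normr_ge0 (ln m); lra.
have mdel : 2^-1 <= m `^ del.
  rewrite /powR gt_eqF //; apply: le_trans (expR_ge1Dx _).
  have : - (del * `|ln m|) <= del * ln m.
    by rewrite -mulrN ler_pM2l // lerNl; have := ler_norm (- ln m); rewrite normrN.
  have : del * `|ln m| <= 2^-1.
    by rewrite /del invfM -mulrA ler_piMr // ler_pdivrMl ?ltr_pwDl // mulr1 lerDr.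
  by lra.
(* On [s1] the subtracted term is at most a quarter of Phi^al, while Phi^(al + del) is at least half
   of it; this explains the factor 4 in [lb]. *)
have [eps eps0 Heps] := finite_pos_min (finite_seq s1)
  (fun x _ => divr_gt0 (Pb_gt0 x al) (mulr_gt0 (ltr0n R 4) (Pb_gt0 x 2^-1))).
have lb x : x \in s1 -> Phi x `^ al <=
    4 * Num.max 0 (Phi x `^ (al + del) + Phi x `^ (al + del + e) - eps * Phi x `^ 2^-1).
  move=> xs; have e1 : eps * Phi x `^ 2^-1 <= 4^-1 * Phi x `^ al.
    have := Heps x xs; rewrite ler_pdivlMr ?mulr_gt0 // => h.
    by rewrite ler_pdivlMl // mulrCA.
  have e2 : 2^-1 * Phi x `^ al <= Phi x `^ (al + del).
    rewrite (PhiD hd hPhi) mulrC ler_pM2l //; apply: le_trans mdel _.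
    by apply: ler_powRl; rewrite ?(ltW del0) ?(ltW m0) // Hm.
  have e3 := Pb_gt0 x (al + del + e).
  rewrite -ler_pdivrMl // le_max; apply/orP; right; lra.
apply: (@le_trans _ _ (C * \sum_(x <- s1) Phi x `^ al * g x)).
  rewrite mulr_sumr; apply: ler_sum => x _; rewrite mulrA mulrC ler_wpM2r //.
  exact: (proj2 (HC x)).
rewrite ler_pM2l //; pose phi x : R :=
  Num.max 0 (Phi x `^ (al + del) + Phi x `^ (al + del + e) - eps * Phi x `^ 2^-1).
apply: (@le_trans _ _ (4 * \sum_(x <- s1) phi x * g x)); last first.
  by rewrite ler_pM2l //; apply: bound => //; lra.
rewrite mulr_sumr big_seq [leRHS]big_seq; apply: ler_sum => x xs.
by rewrite mulrA ler_wpM2r // lb.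
Qed.

End HardyPoisson.

(** * Oscillation and nonexistence below the critical coupling *)

Section Supercritical.
Variables (R : realType) (d : nat) (Phi H0 : lattice d -> R).
Hypothesis hd : (3 <= d)%N.
Hypothesis hPhi : fundamental_solution Phi.
Hypothesis hH0 : forall x, 0 <= H0 x <= Hbar Phi x.
Hypothesis hlim : exists eps0 : R, 0 < eps0 < 1 /\
  (0 <= limsup_at_infinity
          (fun x => ((Hbar Phi x - H0 x) * enorm R x `^ eps0
                       / Hbar Phi x)%:E) < +oo)%E.
Implicit Types (x y : lattice d) (u v phi : lattice d -> R) (mu b w : R).

Let d_gt0 : (0 < d)%N := leq_trans (isT : (0 < 3)%N) hd.
Let P_gt0 x : 0 < Phi x := Phi_gt0 hd hPhi x.
Let P_ge0 x : 0 <= Phi x := ltW (P_gt0 x).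
Let Pb_gt0 x b : 0 < Phi x `^ b. Proof. exact: powR_gt0. Qed.
Let Hb_ge0 := Hbar_ge0 hH0.

(** At a zero of [u] the equation forces the neighbour sum to be nonpositive, so zeros spread
    everywhere and [f] would vanish. *)
Lemma solution_gt0 mu (f u : lattice d -> R) : (forall x, 0 <= f x) ->
  (exists x, f x <> 0) -> poisson_solution H0 mu f u -> forall x, 0 < u x.
Proof.
move=> f0 [x1 fx1] [Lu u0] x0; rewrite lt_neqAle u0 andbT; apply/eqP => z0.
have uz : forall x, u x = 0.
  apply: (@adj_ind _ _ x0) => // x y xy ux; apply/le_anti; rewrite u0 andbT.
  apply: le_trans (@le_nsum _ _ u x y (fun z _ => u0 z) xy) _.
  by have := f0 x; rewrite -Lu hardyE ux mulr0 sub0r oppr_ge0.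
apply: fx1; rewrite -Lu hardyE uz mulr0 /nsum big1 ?subr0 // => k _.
by rewrite !uz addr0.
Qed.

(** Pairing [phi] with [u] gives a number both nonnegative and nonpositive; as [u > 0], the operator
    on [phi] vanishes on [s], and the zeros of [phi] far out then spread to the whole lattice. *)
Lemma no_solution_of_subsolution mu (f phi : lattice d -> R) :
  (forall x, 0 <= f x) -> (exists x, f x <> 0) ->
  finite_set [set x | phi x != 0] -> (forall x, 0 <= phi x) -> (exists x, phi x != 0) ->
  (forall x, hardy_op H0 mu phi x <= 0) -> forall u, ~ poisson_solution H0 mu f u.
Proof.
move=> f0 fn0 fin phi0 [x0 px0] Lphi u Hu.
have u_gt0 := solution_gt0 f0 fn0 Hu; have [Lu u0] := Hu.
have [s cs _] := closingP fin (finite_set0 _).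
have H := sum_by_parts H0 mu u cs.
have L0 x : x \in s -> hardy_op H0 mu phi x = 0.
  move=> xs; have : \sum_(x <- s) u x * - hardy_op H0 mu phi x = 0.
    apply/le_anti/andP; split; last first.
      by apply: sumr_ge0 => y _; rewrite mulr_ge0 // oppr_ge0.
    under eq_bigr do rewrite mulrN; rewrite sumrN -H oppr_le0.
    by apply: sumr_ge0 => y _; rewrite Lu mulr_ge0.
  move=> /eqP; rewrite psumr_eq0; last by move=> y _; rewrite mulr_ge0 // oppr_ge0.
  move=> /allP /(_ x xs) /=; rewrite mulrN oppr_eq0 mulf_eq0 gt_eqF //= => /eqP //.
have [x1 nx1] := far_exists d_gt0 (finite_near R fin).
have pz : forall x, phi x = 0.
  apply: (@adj_ind _ _ x1) => [|x y xy px]; first by apply/eqP; apply: contrapT => /negP.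
  apply/eqP; apply: contrapT => /negP py.
  (* The neighbours of the support are in [s] too, so the vanishing of the operator at the zero [x]
     reads [nsum phi x = 0]. *)
  have xs : x \in s by case: (proj2 cs y py) => _; apply; rewrite adj_sym.
  have := L0 x xs; rewrite hardyE px mulr0 sub0r => /eqP; rewrite oppr_eq0 => /eqP n0.
  have := @le_nsum _ _ phi x y (fun z _ => phi0 z) xy; rewrite n0 => h.
  by move: py; rewrite eq_le h phi0.
by move: px0; rewrite pz eqxx.
Qed.

(* With [w = exp (b t)] and [phi = Phi^{1/2} h(w)], the operator acts on [h] to
   leading order as a multiple of [- h'' + (1 + mu) / 4 h] in the variable [t].
   The cubic is positive exactly on (1, 10) below 12, and chosen convex (in [t])
   at 1 and 10, so that it is a strict subsolution wherever it is nonnegative; the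
   factors [1 + k^2 / 20] of [w^k] below come from the choice [4 b^2 = - (1 + mu) / 20]. *)
Definition cubic w : R := (w - 1) * (w - 10) * (w - 12).

Lemma cubic_subsolution w : 1 <= w <= 10 ->
  2 <= - 120 + 142 * (1 + 20^-1) * w - 23 * (1 + 4 / 20) * w ^+ 2 + (1 + 9 / 20) * w ^+ 3.
Proof.
move=> /andP[w1 w10].
(* The polynomial is exactly this product plus 2.95. *)
have : 0 <= (w - 1) * (145 / 100 * (w - 9) ^+ 2 + (11 / 2 - w / 20)).
  apply: mulr_ge0; first by lra.
  by apply: addr_ge0; [apply: mulr_ge0; [lra|exact: sqr_ge0]|lra].
by lra.
Qed.

Lemma no_solution_supercritical mu (f : lattice d -> R) : mu < -1 ->
  (forall x, 0 <= f x) -> (exists x, f x <> 0) -> forall u, ~ poisson_solution H0 mu f u.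
Proof.
move=> mu1 f0 fn0.
pose N : R := - (1 + mu); have N0 : 0 < N by rewrite /N; lra.
pose b : R := Num.sqrt (N / 20) / 2.
have b0 : 0 < b by rewrite divr_gt0 // sqrtr_gt0 divr_gt0.
have bb : 4 * b ^+ 2 = N / 20.
  have : Num.sqrt (N / 20) ^+ 2 = N / 20 by rewrite sqr_sqrtr // ltW // divr_gt0.
  by rewrite /b expr_div_n => ->; field.
have [r r0 Hr] := hardy_Phi_powR hd hPhi hH0 hlim mu.
have [K K0 HK] := Hr (2^-1 + 3 * b) ltac:(lra).
have [C C0 HC] := Phi_rel_grad hd hPhi.
have [L [L0 LE]] : exists L : R, 0 < L /\ 5 * 10 ^+ 3 <= L.
  by exists (5 * 10 ^+ 3); rewrite mulr_gt0 ?exprn_gt0.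
(* A ratio of values of [Phi] up to [qb] multiplies [w] by at most 6/5, so from [w < 10] a neighbour
   stays below 12, the last root of [cubic]. *)
pose qb : R := (6 / 5) `^ b^-1.
have qb1 : 1 < qb.
  have <- : (1 : R) `^ b^-1 = 1 by rewrite powR1.
  by apply: gt0_ltr_powR; rewrite ?invr_gt0 ?nnegrE //; lra.
pose good x := [/\ forall k : nat, (k <= 3)%N ->
     `|hardy_op H0 mu (fun y => Phi y `^ (2^-1 + k%:R * b)) x
       + N * (1 + k%:R ^+ 2 / 20) * Hbar Phi x * Phi x `^ (2^-1 + k%:R * b)|
     <= K * Phi x `^ r * Hbar Phi x * Phi x `^ (2^-1 + k%:R * b),
     L * (K * Phi x `^ r) <= N &
     forall y, adj x y -> (Phi y / Phi x) `^ b <= 6 / 5].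
have nearA : \forall x \near at_infinity R d, good x.
  near=> x; split.
  - move=> k k3; have k3R : k%:R <= 3 :> R by rewrite ler_nat.
    have HKx : forall c, `|c| <= 2^-1 + 3 * b -> `|hardy_op H0 mu (fun y => Phi y `^ c) x
         - (mu - 4 * c * (c - 1)) * Hbar Phi x * Phi x `^ c|
      <= K * Phi x `^ r * Hbar Phi x * Phi x `^ c by near: x.
    have kb : k%:R * b <= 3 * b by rewrite ler_pM2r.
    have kb0 : 0 <= k%:R * b by rewrite mulr_ge0 ?(ltW b0).
    have := HKx (2^-1 + k%:R * b) ltac:(rewrite ger0_norm; lra).
    rewrite (_ : mu - _ = - (N * (1 + k%:R ^+ 2 / 20))); last first.
      have -> : N * (1 + k%:R ^+ 2 / 20) = N + k%:R ^+ 2 * (4 * b ^+ 2) by rewrite bb; field.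
      by rewrite /N; field.
    by rewrite !mulNr opprK.
  - have : Phi x `^ r < N / (L * K).
      by near: x; apply: near_Phi_powR => //; rewrite divr_gt0 // mulr_gt0.
    by rewrite ltr_pdivlMr ?mulr_gt0 // => /ltW; rewrite mulrCA [_ * K]mulrC.
  - move=> y xy.
    have wq : C * weight R x `^ (- 2^-1) <= qb - 1.
      rewrite -ler_pdivlMl //; apply: ltW; near: x; apply: near_weight => //.
      by rewrite mulr_gt0 ?invr_gt0 // subr_gt0.
    have : Phi y / Phi x <= qb.
      rewrite ler_pdivrMr //; have := HC x y xy.
      have := ler_wpM2r (P_ge0 x) wq; rewrite ler_norml => h /andP[_]; lra.
    move=> h; apply: le_trans (_ : qb `^ b <= _).
      by apply: ler_powRl => //; rewrite ?(ltW b0) // divr_ge0.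
    by rewrite /qb -powRrM mulVf ?gt_eqF // powRr1 //; lra.
have fin := near_finite nearA.
have [m m0 Hm] := finite_pos_min fin (fun x _ => P_gt0 x).
(* Far enough out that [w = 10], that is Phi = 2^(1/b) Phi(x0), only occurs where [Phi < m], hence
   where [good] holds. *)
have [x0 Hx0] : exists x0, Phi x0 < m / 2 `^ b^-1.
  apply: (far_exists d_gt0); have := @near_Phi_powR _ _ _ hd hPhi 1 (m / 2 `^ b^-1) ltr01.
  move=> /(_ (divr_gt0 m0 (powR_gt0 _ (ltr0n R 2)))); apply: filterS => x.
  by rewrite powRr1.
(* Normalizes [w x0] to 5, where [cubic] is positive. *)
pose zeta := Phi x0 * 5 `^ (- b^-1); have z0 : 0 < zeta by rewrite mulr_gt0 // powR_gt0.
pose w x := (Phi x / zeta) `^ b.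
have w_gt0 x : 0 < w x by rewrite powR_gt0 // divr_gt0.
have b_inv0 : 0 < b^-1 by rewrite invr_gt0.
have w_gt t x : 0 < t -> zeta * t `^ b^-1 < Phi x -> t < w x.
  move=> t0 h; rewrite -[ltLHS]powRr1 ?(ltW t0) // -(mulVf (lt0r_neq0 b0)) powRrM.
  apply: gt0_ltr_powR => //; rewrite ?nnegrE ?powR_ge0 ?divr_ge0 ?(ltW z0) //.
  by rewrite ltr_pdivlMr // mulrC.
have w_small x : w x <= 10 -> Phi x < m.
  move=> w10; rewrite ltNge; apply/negP => mx.
  have : 10 < w x; last by rewrite ltNge w10.
  apply: w_gt => //; apply: lt_le_trans mx; move: Hx0; rewrite ltr_pdivlMr ?powR_gt0 //.
  rewrite /zeta (_ : 10 = 5 * 2 :> R); last by ring.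
  rewrite powRM // powRN mulrA divfK //; rewrite gt_eqF // powR_gt0 //.
pose P x := Phi x `^ 2^-1 * cubic (w x).
(* The cutoff lies between the roots 10 and 12, where [cubic] is negative, and discards the region
   beyond 12 where it is positive again. *)
pose phi x := if w x < 11 then Num.max 0 (P x) else 0.
have cub0 t : t <= 1 -> cubic t <= 0.
  by move=> t1; rewrite /cubic -mulrA mulr_le0_ge0 ?mulr_le0 //; lra.
have phi_gt0 x : phi x != 0 -> [/\ 1 < w x, w x < 10 & phi x = P x].
  rewrite /phi; case: ifP => [w11|]; last by rewrite eqxx.
  have [Px|Px] := leP (P x) 0; first by rewrite eqxx.
  move=> _; have cw : 0 < cubic (w x) by move: Px; rewrite pmulr_rgt0.
  have w1 : 1 < w x by rewrite ltNge; apply/negP => /cub0; rewrite leNgt cw.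
  split => //; rewrite ltNge; apply/negP => w10.
  suff : cubic (w x) <= 0 by rewrite leNgt cw.
  by rewrite /cubic mulr_ge0_le0 ?mulr_ge0 //; lra.
apply: (@no_solution_of_subsolution mu f phi) => //.
- apply: sub_finite_set (near_finite (near_Phi hPhi z0)) => x /= /phi_gt0[w1 _ _].
  rewrite gtr0_norm // => h; have : w x <= 1; last by rewrite leNgt w1.
  have <- : (1 : R) `^ b = 1 by rewrite powR1.
  apply: ler_powRl; rewrite ?(ltW b0) ?divr_ge0 ?(ltW z0) //.
  by rewrite ler_pdivrMr // mul1r ltW.
- by move=> x; rewrite /phi; case: ifP => // _; rewrite le_max lexx.
- exists x0; have w5 : w x0 = 5.
    rewrite /w /zeta powRN invfM invrK mulrA mulfV ?gt_eqF // mul1r -powRrM.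
    by rewrite mulVf ?gt_eqF // powRr1.
  have : 0 < P x0 by rewrite /P w5 mulr_gt0 // /cubic; lra.
  by move=> P0; rewrite /phi w5 ifT ?ltr_nat // gt_eqF // lt_max P0 orbT.
move=> x; have [px|px] := eqVneq (phi x) 0.
  rewrite hardyE px mulr0 sub0r oppr_le0 nsum_ge0 // => y _.
  by rewrite /phi; case: ifP => // _; rewrite le_max lexx.
have [w1 w10 phiP] := phi_gt0 x px.
have [A1 A2 A3] : good x.
  apply: contrapT => bad; have := Hm x bad.
  by rewrite leNgt w_small // ltW.
(* At [x] both functions agree; at neighbours [w <= 12], so [phi] is at least [P] there. *)
have hle : hardy_op H0 mu phi x <= hardy_op H0 mu P x.
  rewrite !hardyE phiP lerD2l lerN2; apply: ler_nsum => y xy.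
  have wy : w y <= 12.
    have -> : w y = (Phi y / Phi x) `^ b * w x.
      rewrite -powRM ?divr_ge0 ?(ltW z0) //; congr (_ `^ _).
      by field; rewrite !gt_eqF.
    apply: le_trans (_ : 6 / 5 * 10 <= _); last by lra.
    by apply: ler_pM; rewrite ?powR_ge0 ?A3 ?ltW.
  rewrite /phi; case: ltP => w11; first by rewrite le_max lexx orbT.
  by rewrite pmulr_rle0 // /cubic mulr_ge0_le0 ?mulr_ge0 //; lra.
apply: le_trans hle _.
(* These factors turn powers of [w] into powers of [Phi], so [P] becomes a combination of the four
   powers controlled by [good]. *)
pose c (k : nat) : R := zeta `^ (- (k%:R * b)).
have c0 k : 0 < c k by exact: powR_gt0.
have cw k y : c k * Phi y `^ (2^-1 + k%:R * b) = Phi y `^ 2^-1 * w y ^+ k.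
  rewrite (PhiD hd hPhi) mulrCA; congr (_ * _).
  rewrite /w -powR_mulrn ?powR_ge0 // -powRrM [b * _]mulrC powRM ?invr_ge0 ?(ltW z0) //.
  by rewrite -(powR_inv1 (ltW z0)) -powRrM mulN1r; exact: mulrC.
have PE : P = fun y => (- 120 * c 0%N) * Phi y `^ (2^-1 + 0%:R * b)
    + (142 * c 1%N) * Phi y `^ (2^-1 + 1%:R * b)
    + (- 23 * c 2%N) * Phi y `^ (2^-1 + 2%:R * b)
    + c 3%N * Phi y `^ (2^-1 + 3%:R * b).
  by apply/funext => y; rewrite -!mulrA !cw /P /cubic; ring.
pose l k := c k * hardy_op H0 mu (fun y => Phi y `^ (2^-1 + k%:R * b)) x.
have -> : hardy_op H0 mu P x = - 120 * l 0%N + 142 * l 1%N - 23 * l 2%N + l 3%N.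
  by rewrite PE !hardyD !hardyZ /l; ring.
pose q := Hbar Phi x * Phi x `^ 2^-1; have q0 : 0 <= q by rewrite mulr_ge0 ?(ltW (Pb_gt0 _ _)).
pose e := K * Phi x `^ r; have e0 : 0 <= e by rewrite mulr_ge0 ?(ltW K0) ?powR_ge0.
have lk k : (k <= 3)%N -> `|l k + N * (1 + k%:R ^+ 2 / 20) * q * w x ^+ k| <= e * q * w x ^+ k.
  move=> /A1; rewrite -(ler_pM2l (c0 k)) -[X in X * _ <= _](gtr0_norm (c0 k)) -normrM.
  have -> : e * q * w x ^+ k = c k * (K * Phi x `^ r * Hbar Phi x * Phi x `^ (2^-1 + k%:R * b)).
    by rewrite [RHS]mulrCA cw /e /q; ring.
  apply: le_trans; rewrite le_eqVlt; apply/orP; left; apply/eqP; congr `|_|.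
  by rewrite [RHS]mulrDr [X in _ = _ + X]mulrCA cw /l /q; ring.
have := lk 3%N isT; have := lk 2%N isT; have := lk 1%N isT; have := lk 0%N isT.
rewrite -/e in A2.
move: (l 0%N) (l 1%N) (l 2%N) (l 3%N) => l0 l1 l2 l3.
rewrite !ler_norml => /andP[B0 _] /andP[_ B1] /andP[B2 _] /andP[_ B3].
have F := cubic_subsolution (_ : 1 <= w x <= 10).
have {}F : N * q * 2 <= N * q * (- 120 + 142 * (1 + 20^-1) * w x
    - 23 * (1 + 4 / 20) * w x ^+ 2 + (1 + 9 / 20) * w x ^+ 3).
  by apply: ler_wpM2l; [rewrite mulr_ge0 ?(ltW N0)|apply: F; rewrite !ltW].
have G1 : 120 + 142 * w x + 23 * w x ^+ 2 + w x ^+ 3 <= L.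
  have h1 : w x ^+ 2 <= 10 ^+ 2 by rewrite lerXn2r ?nnegrE ?ltW.
  have h2 : w x ^+ 3 <= 10 ^+ 3 by rewrite lerXn2r ?nnegrE ?ltW.
  by lra.
(* The errors total at most [N * q], while the main part is at most [- (N * q * 2)] by [F]. *)
have G : e * q * (120 + 142 * w x + 23 * w x ^+ 2 + w x ^+ 3) <= N * q.
  apply: (@le_trans _ _ (L * e * q)); last by rewrite ler_wpM2r.
  by rewrite -[leRHS]mulrA [leRHS]mulrC; apply: ler_wpM2l => //; exact: mulr_ge0.
have Nq : 0 <= N * q by rewrite mulr_ge0 ?(ltW N0).
move: (w x) B0 B1 B2 B3 F G => ww B0 B1 B2 B3 F G.
by lra.
Unshelve. all: by end_near. Qed.

End Supercritical.

Theorem theorem1p2 (R : realType) (d : nat) (hd : (3 <= d)%N)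
    (Phi : lattice d -> R) (hPhi : fundamental_solution Phi)
    (H0 : lattice d -> R)
    (hH0 : forall x, 0 <= H0 x <= Hbar Phi x)
    (hlim : exists eps0 : R, 0 < eps0 < 1 /\
      (0 <= limsup_at_infinity
              (fun x => ((Hbar Phi x - H0 x) * enorm R x `^ eps0
                           / Hbar Phi x)%:E) < +oo)%E)
    (g : lattice d -> R) (hg : forall x, 0 <= g x) (mu : R) :
  [/\ (* (a) *)
      -1 <= mu ->
      (mu = -1 -> forall x, H0 x < Hbar Phi x) ->
      (weighted_sum mu g < +oo)%E ->
      exists v, minimal_poisson_solution H0 mu g v,
      (* (b) *)
      -1 <= mu ->
      weighted_sum mu g = +oo%E ->
      forall u, ~ poisson_solution H0 mu g u
    & (* (c) *)
      mu < -1 ->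
      forall f : lattice d -> R,
        (forall x, 0 <= f x) -> (exists x, f x <> 0) ->
        forall u, ~ poisson_solution H0 mu f u].
Proof.
split => [mu1 muH fin|mu1 inf|mu1 f f0 fn0].
- exact: (minimal_solution_exists hd hPhi).
- exact: (no_solution_infinite hd hPhi).
- exact: (no_solution_supercritical hd hPhi).
Qed.
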